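(* Let $d\ge 1$ and let $\mathbf{F}_d$ be the free group on $d$ generators. The following hold: (1) For every finite alphabet $A$, the set of finite subshifts in $\mathcal{S}_{\mathrm{min\text{-}pmp}}(A^{\mathbf{F}_d})$ is dense in $\mathcal{S}_{\mathrm{min\text{-}pmp}}(A^{\mathbf{F}_d})$, the space of all minimal, pmp subshifts of $A^{\mathbf{F}_d}$. (2) The space $\Xi_{\mathrm{min\text{-}pmp}}(\mathbf{F}_d)$ of minimal, pmp actions of $\mathbf{F}_d$ on the Cantor space has a comeager conjugacy class whose elements are isomorphic to the universal profinite action of $\mathbf{F}_d$.
   Context: $\Omega$ denotes the Cantor space; $\mathrm{Homeo}(\Omega)$ carries the uniform convergence topology. For a countable group $G$, $\Xi(G)=\mathrm{Hom}(G,\mathrm{Homeo}(\Omega))$ is the Polish space of actions of $G$ on $\Omega$ by homeomorphisms, a closed subspace of $\mathrm{Homeo}(\Omega)^G$. $\mathrm{Homeo}(\Omega)$ acts on it by conjugation, $(f\cdot\xi)(g)=f\xi(g)f^{-1}$; orbits are called conjugacy classes. An action on a compact space is minimal if it has no proper non-empty closed invariant subset, and pmp if it admits an invariant Borel probability measure. $\Xi_{\mathrm{min\text{-}pmp}}(G)\subseteq\Xi(G)$ is the set of actions which are minimal and pmp; it is $G_\delta$ in $\Xi(G)$, hence Polish. For a finite (non-empty) alphabet $A$, $G$ acts on $A^G$ by $(g\cdot x)(h)=x(g^{-1}h)$. A subshift is a non-empty closed $G$-invariant subset of $A^G$. The space $\mathcal{S}(A^G)$ of all subshifts of $A^G$ has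 the Vietoris topology, and $\mathcal{S}_{\mathrm{min\text{-}pmp}}(A^G)$ is the subspace of those subshifts which are minimal and pmp. The universal profinite action of $G$ is the action of $G$ by left translation on its profinite completion (the inverse limit of all finite quotients of $G$). Two actions are isomorphic if there is an equivariant homeomorphism between them. *)

(* Defs.v *)
From HB Require Import structures.
From mathcomp Require Import all_boot.
From mathcomp Require Import all_classical all_reals all_analysis.

Set Implicit Arguments.
Unset Strict Implicit.
Unset Printing Implicit Defensive.

Local Open Scope classical_set_scope.
Local Open Scope group_scope.

(* The letter (i, false) stands for the generator i and (i, true) for its
   inverse. *)
Notation letter d := ('I_d * bool)%type.

Definition inv_letter d (a : letter d) : letter d := (a.1, ~~ a.2).

Definition reduced d (w : seq (letter d)) : bool :=
  sorted (fun a b => b != inv_letter a) w.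

Record free_group (d : nat) : Type := FreeGroup {
  word :> seq (letter d);
  _ : reduced word
}.

HB.instance Definition _ d := [isSub for @word d].
HB.instance Definition _ d := [Countable of free_group d by <:].

Section FreeGroup.
Variable d : nat.
Implicit Types (a b : letter d) (u v w : seq (letter d)).

Lemma inv_letterK : involutive (@inv_letter d).
Proof. by case=> i e; rewrite /inv_letter /= negbK. Qed.

Definition cons_red a w : seq (letter d) :=
  if w is b :: w' then if b == inv_letter a then w' else a :: w else [:: a].

Lemma cons_red_reduced a w : reduced w -> reduced (cons_red a w).
Proof.
case: w => [|b w] //= wr; case: ifPn => [_|ba]; first exact: path_sorted wr.
by rewrite /= ba.
Qed.

Definition mul_word u v : seq (letter d) := foldr cons_red v u.

Lemma mul_word_reduced u v : reduced v -> reduced (mul_word u v).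
Proof. by move=> vr; elim: u => //= a u IH; exact: cons_red_reduced. Qed.

Lemma cons_redK a w : reduced w -> cons_red a (cons_red (inv_letter a) w) = w.
Proof.
case: w => [|b w] wr /=; first by rewrite eqxx.
rewrite inv_letterK; case: eqP => [ba|_] /=; last by rewrite eqxx.
subst b; case: w wr => [|c w] //= /andP[ca _].
by rewrite (negbTE ca).
Qed.

Lemma cons_red_mul a u v : reduced v ->
  mul_word (cons_red a u) v = cons_red a (mul_word u v).
Proof.
move=> vr; case: u => [|b u] //=; case: eqP => [->|//] /=.
by apply/esym/cons_redK/mul_word_reduced.
Qed.

Lemma mul_wordA u v w : reduced w ->
  mul_word u (mul_word v w) = mul_word (mul_word u v) w.
Proof. by move=> wr; elim: u => //= a u ->; rewrite cons_red_mul. Qed.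

Lemma mul_word_nil u : reduced u -> mul_word u [::] = u.
Proof.
elim: u => //= a u IH ur; rewrite IH; last exact: path_sorted ur.
by case: u ur {IH} => //= b u /andP[/negbTE->].
Qed.

Definition inv_word u : seq (letter d) := rev [seq inv_letter a | a <- u].

Lemma inv_word_reduced u : reduced u -> reduced (inv_word u).
Proof.
rewrite /reduced /inv_word rev_sorted sorted_map; apply: sub_sorted => a b /=.
by apply: contra => /eqP/(can_inj inv_letterK) ->; rewrite inv_letterK.
Qed.

Lemma inv_wordK u : inv_word (inv_word u) = u.
Proof.
by rewrite /inv_word map_rev revK -map_comp map_id_in // => a _ /=; exact: inv_letterK.
Qed.

Lemma mul_inv_word u v : reduced v -> mul_word (inv_word u) (mul_word u v) = v.
Proof.
elim: u v => //= a u IH v vr.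
rewrite /inv_word /= rev_cons -cats1 /mul_word foldr_cat /=.
have := cons_redK (inv_letter a) (mul_word_reduced u vr).
by rewrite inv_letterK => ->; exact: IH.
Qed.

Definition free_one : free_group d := @FreeGroup d [::] isT.
Definition free_mul (x y : free_group d) : free_group d :=
  FreeGroup (mul_word_reduced (val x) (valP y)).
Definition free_inv (x : free_group d) : free_group d :=
  FreeGroup (inv_word_reduced (valP x)).

Lemma free_mulA : associative free_mul.
Proof. by move=> x y z; apply: val_inj; exact: mul_wordA (valP z). Qed.
Lemma free_mul1g : left_id free_one free_mul.
Proof. by move=> x; apply: val_inj. Qed.
Lemma free_mulg1 : right_id free_one free_mul.
Proof. by move=> x; apply: val_inj; exact: mul_word_nil (valP x). Qed.
Lemma free_mulVg : left_inverse free_one free_inv free_mul.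
Proof.
move=> x; apply: val_inj; rewrite /= -{2}(mul_word_nil (valP x)).
exact: mul_inv_word.
Qed.
Lemma free_mulgV : right_inverse free_one free_inv free_mul.
Proof.
move=> x; rewrite -{1}(_ : free_inv (free_inv x) = x) ?free_mulVg //.
by apply: val_inj; exact: inv_wordK.
Qed.

HB.instance Definition _ := isGroup.Build (free_group d)
  free_mulA free_mul1g free_mulg1 free_mulVg free_mulgV.

Definition free_gen (i : 'I_d) : free_group d := @FreeGroup d [:: (i, false)] isT.

Lemma free_group_universal (H : groupType) (f : 'I_d -> H) :
  exists! phi : free_group d -> H,
    monoid_morphism phi /\ forall i, phi (free_gen i) = f i.
Proof.
pose fl a : H := if a.2 then (f a.1)^-1 else f a.1.
pose ev (w : seq (letter d)) := foldr (fun a h => fl a * h) 1 w.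
have flV a : fl (inv_letter a) = (fl a)^-1.
  by case: a => i []; rewrite /fl /= ?invgK.
have evc a w : ev (cons_red a w) = fl a * ev w.
  case: w => //= b w; case: eqP => //= ->.
  by rewrite flV mulgA mulgV mul1g.
have evM u v : ev (mul_word u v) = ev u * ev v.
  by elim: u => [|a u IH] /=; rewrite ?mul1g // evc IH mulgA.
exists (fun x => ev (val x)); split; first split.
- by split=> // x y; exact: evM.
- by move=> i; rewrite /ev /= mulg1.
move=> psi [[psi1 psiM] psig]; apply/funext => -[w wr] /=.
elim: w wr => [|a w IH] wr /=.
  by rewrite -psi1; congr psi; apply: val_inj.
have wr' : reduced w by exact: path_sorted wr.
have psiV x : psi x^-1 = (psi x)^-1.
  apply: (mulgI (psi x)).
  by rewrite -psiM !mulgV psi1.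
pose xa : free_group d := @FreeGroup d [:: a] isT.
have -> : @FreeGroup d (a :: w) wr = xa * @FreeGroup d w wr'.
  apply: val_inj => /=; case: w wr {IH wr'} => //= b w /andP[/negbTE-> _] //.
rewrite psiM -IH; congr (_ * _).
rewrite /fl {}/xa; case: a {wr} => i [] /=; last first.
  by rewrite -psig; congr psi; apply: val_inj.
by rewrite -psig -psiV; congr psi; apply: val_inj.
Qed.

End FreeGroup.

Definition homeomorphism (T U : topologicalType) (f : T -> U) : Prop :=
  continuous f /\ exists g : U -> T, [/\ continuous g, cancel f g & cancel g f].

Definition isomorphic_actions (G : Type) (T U : topologicalType)
    (alpha : G -> T -> T) (beta : G -> U -> U) : Prop :=
  exists2 f : T -> U, homeomorphism f &
    forall g x, f (alpha g x) = beta g (f x).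

Definition minimal_action (G : Type) (T : topologicalType)
    (alpha : G -> T -> T) : Prop :=
  forall Y : set T, closed Y -> Y !=set0 ->
    (forall g, alpha g @` Y `<=` Y) -> Y = setT.

Definition borel (T : ptopologicalType) := g_sigma_algebraType (@open T).

Definition pmp_action (R : realType) (G : Type) (T : ptopologicalType)
    (alpha : G -> T -> T) : Prop :=
  exists mu : probability (borel T) R,
    forall g (B : set (borel T)), measurable B -> mu (alpha g @^-1` B) = mu B.

Definition nowhere_dense (T : topologicalType) (A : set T) : Prop :=
  interior (closure A) = set0.

Definition meager (T : topologicalType) (A : set T) : Prop :=
  exists2 F : (set T)^nat, (forall n, nowhere_dense (F n)) &
    A `<=` \bigcup_n F n.

Definition comeager (T : topologicalType) (A : set T) : Prop := meager (~` A).

(* A set coerces to the type of its elements, which carries the subspace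
   topology; here the ambient topology is that of uniform convergence. *)
Definition Homeo : Type :=
  [set f : {uniform cantor_space -> cantor_space} |
    @homeomorphism cantor_space cantor_space f].

HB.instance Definition _ := Topological.on Homeo.

Definition homeo_fun (f : Homeo) : cantor_space -> cantor_space := val f.
Coercion homeo_fun : Homeo >-> Funclass.

Lemma homeo_inj (f g : Homeo) : f =1 g -> f = g.
Proof. by move=> fg; apply: val_inj; apply/funext. Qed.

Lemma homeoP (f : Homeo) : homeomorphism f.
Proof. exact: set_mem (valP f). Qed.

Definition mk_homeo (f : cantor_space -> cantor_space)
  (hf : homeomorphism f) : Homeo := SigSub (mem_set hf).

Lemma homeomorphism_id : @homeomorphism cantor_space cantor_space id.
Proof. by split; [|exists id; split]; move=> // x; exact: cvg_id. Qed.

Lemma homeomorphism_comp (T U V : topologicalType) (f : U -> V) (g : T -> U) :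
  homeomorphism f -> homeomorphism g -> homeomorphism (f \o g).
Proof.
move=> [cf [f' [cf' fK f'K]]] [cg [g' [cg' gK g'K]]]; split.
  by move=> x; apply: continuous_comp; [exact: cg|exact: cf].
exists (g' \o f'); split; [|exact: can_comp|exact: can_comp].
by move=> x; apply: continuous_comp; [exact: cf'|exact: cg'].
Qed.

Definition homeo_one : Homeo := mk_homeo homeomorphism_id.

Definition homeo_mul (f g : Homeo) : Homeo :=
  mk_homeo (homeomorphism_comp (homeoP f) (homeoP g)).

Lemma homeo_inv_ex (f : Homeo) :
  exists g : Homeo, cancel f g /\ cancel g f.
Proof.
have [cf [g [cg fK gK]]] := homeoP f.
have hg : homeomorphism g by split=> //; exists f.
by exists (mk_homeo hg).
Qed.

Definition homeo_inv (f : Homeo) : Homeo := projT1 (cid (homeo_inv_ex f)).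

Lemma homeoK (f : Homeo) : cancel f (homeo_inv f).
Proof. by have [] := projT2 (cid (homeo_inv_ex f)). Qed.

Lemma homeoVK (f : Homeo) : cancel (homeo_inv f) f.
Proof. by have [] := projT2 (cid (homeo_inv_ex f)). Qed.

Lemma homeo_mulA : associative homeo_mul.
Proof. by move=> f g h; apply: homeo_inj. Qed.
Lemma homeo_mul1g : left_id homeo_one homeo_mul.
Proof. by move=> f; apply: homeo_inj. Qed.
Lemma homeo_mulg1 : right_id homeo_one homeo_mul.
Proof. by move=> f; apply: homeo_inj. Qed.
Lemma homeo_mulVg : left_inverse homeo_one homeo_inv homeo_mul.
Proof. by move=> f; apply: homeo_inj => x; exact: homeoK. Qed.
Lemma homeo_mulgV : right_inverse homeo_one homeo_inv homeo_mul.
Proof. by move=> f; apply: homeo_inj => x; exact: homeoVK. Qed.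

HB.instance Definition _ := isGroup.Build Homeo
  homeo_mulA homeo_mul1g homeo_mulg1 homeo_mulVg homeo_mulgV.

Definition Xi (G : groupType) : set (prod_topology (fun _ : G => Homeo)) :=
  [set xi | @monoid_morphism G Homeo xi].
Arguments Xi : clear implicits.

Definition cantor_action (G : groupType) (xi : Xi G) :
    G -> cantor_space -> cantor_space :=
  fun g => (val xi g : Homeo).

Lemma conj_subproof (G : groupType) (f : Homeo) (xi : Xi G) :
  Xi G (fun g => f * (val xi g : Homeo) * f^-1).
Proof.
have [xi1 xiM] := set_mem (valP xi).
split=> [|g h] /=; first by rewrite [val xi 1]xi1 mulg1 mulgV.
by rewrite [val xi (g * h)]xiM !mulgA mulgVK.
Qed.

Definition conj_action (G : groupType) (f : Homeo) (xi : Xi G) : Xi G :=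
  SigSub (mem_set (conj_subproof f xi)).

Definition conjugacy_class (G : groupType) (xi : Xi G) : set (Xi G) :=
  range (fun f : Homeo => conj_action f xi).

Definition Xi_min_pmp (R : realType) (G : groupType) : set (Xi G) :=
  [set xi | minimal_action (cantor_action xi) /\
            pmp_action R (cantor_action xi)].
Arguments Xi_min_pmp : clear implicits.

(* The Vietoris topology has the subbase of all {K | K `<=` U} and
   {K | K meets U}, for U open; it is only used on families of closed sets. *)
Definition vietoris (T : topologicalType) : Type := set T.

HB.instance Definition _ (T : topologicalType) := Choice.on (vietoris T).

Definition vietoris_subbase (T : topologicalType) (p : bool * set T) :
    set (vietoris T) :=
  if p.1 then [set K : set T | K `<=` p.2]
  else [set K : set T | K `&` p.2 !=set0].

HB.instance Definition _ (T : topologicalType) :=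
  isSubBaseTopological.Build (vietoris T)
    [set p : bool * set T | open p.2] (@vietoris_subbase T).

Definition full_shift (A : finType) (G : groupType) : Type :=
  prod_topology (fun _ : G => discrete_topology A).

HB.instance Definition _ (A : finType) (G : groupType) :=
  Topological.on (full_shift A G).

Definition shift_action (A : finType) (G : groupType) (g : G)
    (x : full_shift A G) : full_shift A G :=
  fun h => x (g^-1 * h).

Definition subshifts (A : finType) (G : groupType) :
    set (vietoris (full_shift A G)) :=
  [set X | [/\ X !=set0, closed X & forall g, shift_action g @` X `<=` X]].
Arguments subshifts : clear implicits.

Section SubshiftAction.
Variables (A : finType) (G : groupType) (X : subshifts A G).

Lemma subshiftP : subshifts A G (val X).
Proof. exact: set_mem (valP X). Qed.

Definition subshift_space : Type := (val X : set (full_shift A G)).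

HB.instance Definition _ := Topological.on subshift_space.

Lemma subshift_space_ex : exists x : subshift_space, True.
Proof. by have [[x Xx] _ _] := subshiftP; exists (SigSub (mem_set Xx)). Qed.

HB.instance Definition _ :=
  isPointed.Build subshift_space (projT1 (cid subshift_space_ex)).

Lemma shift_subproof (g : G) (x : subshift_space) :
  (val X : set (full_shift A G)) (shift_action g (val x)).
Proof.
by have [_ _ +] := subshiftP; apply; exists (val x) => //; exact: set_mem (valP x).
Qed.

Definition subshift_action (g : G) (x : subshift_space) : subshift_space :=
  SigSub (mem_set (shift_subproof g x)).

End SubshiftAction.

Definition S_min_pmp (R : realType) (A : finType) (G : groupType) :
    set (subshifts A G) :=
  [set X | minimal_action (@subshift_action A G X) /\
           pmp_action R (@subshift_action A G X)].
Arguments S_min_pmp : clear implicits.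

Definition finite_subshift (A : finType) (G : groupType)
    (X : subshifts A G) : Prop :=
  finite_set (val X : set (full_shift A G)).

Definition lcoset (G : groupType) (g : G) (N : set G) : set G :=
  [set g * h | h in N].

Definition cosets (G : groupType) (N : set G) : set (set G) :=
  range (fun g => lcoset g N).

Definition finite_index_normal (G : groupType) : set (set G) :=
  [set N | [/\ N 1,
               forall g h, N g -> N h -> N (g * h^-1),
               forall g h, N g -> N (g ^ h)
             & finite_set (cosets N)]].
Arguments finite_index_normal : clear implicits.

Definition quotient (G : groupType) (N : set G) : Type :=
  discrete_topology (cosets N).

HB.instance Definition _ (G : groupType) (N : set G) :=
  Topological.copy (quotient N) (discrete_topology (cosets N)).

Lemma translate_subproof (G : groupType) (N : set G) (g : G)
  (C : quotient N) : cosets N (lcoset g (val (C : cosets N))).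
Proof.
have [k _ e] := set_mem (valP (C : cosets N)); rewrite -e; exists (g * k) => //.
rewrite /lcoset; apply/seteqP; split=> z /=.
  by move=> [h Nh <-]; exists (k * h); [exists h|rewrite mulgA].
by move=> [_ [h Nh <-] <-]; exists h => //; rewrite mulgA.
Qed.

Definition translate (G : groupType) (N : set G) (g : G) (C : quotient N) :
    quotient N :=
  SigSub (mem_set (translate_subproof g C)).

(* For N `<=` M, the projection of G/N onto G/M sends a coset of N to the coset
   of M containing it. *)
Definition profinite_completion (G : groupType) :
    set (prod_topology (fun N : finite_index_normal G => quotient (val N))) :=
  [set x | forall N M : finite_index_normal G,
    val N `<=` val M -> val (x N : cosets (val N)) `<=` val (x M : cosets (val M))].
Arguments profinite_completion : clear implicits.

Lemma profinite_subproof (G : groupType) (g : G) (x : profinite_completion G) :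
  profinite_completion G (fun N => translate g (val x N)).
Proof.
move=> N M NM _ [h xNh <-]; exists h => //.
by have := set_mem (valP x) N M NM; exact.
Qed.

Definition universal_profinite_action (G : groupType) (g : G)
    (x : profinite_completion G) : profinite_completion G :=
  SigSub (mem_set (@profinite_subproof G g x)).

(* Main.v *)
From HB Require Import structures.
From mathcomp Require Import perm.
Require Import Defs.
From mathcomp Require Import all_boot all_order all_algebra.
From mathcomp Require Import lra.
From mathcomp Require Import all_classical all_reals all_analysis.

(** Everything rests on one finite approximation statement,
[finite_pattern_model]: if the free group preserves a probability measure, then
the patterns that a finite colouring shows through a finite window also arise
on a finite set carrying an action of the free group. Take the patterns on a
ball as the vertices of a graph. For a generator s, the measure of the set of
points whose pattern is p and whose image under s has pattern q defines a flow
on this graph, and invariance of the measure says that the inflow and the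
outflow at p are both the measure of p, for every generator. These conservation
laws have integer coefficients, so a good enough simultaneous Diophantine
approximation of the flow satisfies them exactly ([integral_flow]). An integral
flow is a finite set of coloured points with one permutation for each generator
([finite_flow_model]); freeness of the group turns the permutations into an
action, and each edge that is used is realised by an actual point.

Density of the finite subshifts ([finite_subshifts_dense]): for a minimal
subshift X, meeting an open set U amounts to being contained in the union of
the translates of U, so by compactness every subshift whose patterns in a large
window all occur in X is close to X. The orbit of a point of a finite model
whose patterns come from X is such a subshift, and it carries the uniform
measure.

The generic conjugacy class ([generic_conjugacy_class]) is that of an action
which is minimal, whose locally constant colourings all factor through finite
actions ([profinite_action]), and which has every finite action as a factor
([universal_action]).

- These three properties determine the action up to isomorphism: it is the
  universal profinite action ([isomorphic_completion]).
- The last two are countable intersections of open conditions, since a factor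
  map onto a finite action is still one for all nearby actions
  ([factors_onto_near]).
- Conjugates of a universal action are dense ([conjugates_approximate]): a
  finite model for the patterns of a fine clopen partition is a factor of the
  universal action, hence gives a clopen partition behaving like the given one,
  and a homeomorphism of Cantor space matches the two.
- Such an action exists ([profinite_universal_minimal_ex]): put all finite
  actions side by side on the natural numbers, let the group permute the
  coordinates of Cantor space accordingly, and take the orbit closure of the
  point that marks one element in each finite action. This closure is again a
  Cantor space.
- It has an invariant measure ([profinite_pmp]): a limit along an ultrafilter
  of uniform measures on sections of finite factors is a finitely additive
  invariant mean, and on Cantor space any mean restricted to the clopen sets
  extends to a Borel probability. *)

Set Implicit Arguments.
Unset Strict Implicit.
Unset Printing Implicit Defensive.

Import Order.TTheory GRing.Theory Num.Theory.
Import numFieldNormedType.Exports.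
Local Open Scope classical_set_scope.

(** * Integral approximation of invariant flows *)

Section Approximation.
Local Open Scope ring_scope.
Variable R : realType.

(** Dirichlet's theorem, by the pigeonhole principle applied to the fractional
parts of the multiples of u. *)
Lemma simultaneous_approximation (J : finType) (u : J -> R) (M : nat) :
  (0 < M)%N ->
  exists (q : nat) (n : J -> int), (0 < q)%N /\
    forall j, `|q%:R * u j - (n j)%:~R| < M%:R^-1.
Proof.
case: M => // M _.
pose fr (q : nat) j : R := q%:R * u j - (Num.floor (q%:R * u j))%:~R.
have fr0 q j : 0 <= fr q j by rewrite subr_ge0 ge_floor.
have fr1 q j : fr q j < 1.
  by rewrite ltrBlDr addrC; have := floorD1_gt (q%:R * u j); rewrite intrD.
have Mp : 0 < M.+1%:R :> R by rewrite ltr0n.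
(* One multiple more than there are boxes of side 1/(M+1) in the unit cube. *)
pose box (q : 'I_(M.+1 ^ #|J|).+1) :=
  [ffun j => inord (Num.trunc (M.+1%:R * fr q j)) : 'I_M.+1].
have : ~~ injectiveb box.
  apply/negP => /injectiveP/leq_card.
  by rewrite card_ord card_ffun card_ord ltnn.
case/injectivePn => a [b ab boxab].
wlog {ab} ab : a b boxab / (b < a)%N.
  move=> H; case: (ltngtP a b) => [ba|ba|/val_inj e].
  - exact: (H b a).
  - exact: (H a b).
  - by rewrite e eqxx in ab.
exists (a - b)%N, (fun j => Num.floor (a%:R * u j) - Num.floor (b%:R * u j)).
split=> [|j]; first by rewrite subn_gt0.
have -> : (a - b)%:R * u j -
    (Num.floor (a%:R * u j) - Num.floor (b%:R * u j))%:~R = fr a j - fr b j.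
  rewrite natrB; last exact: ltnW.
  by rewrite intrB /fr; lra.
rewrite -[ltRHS]mul1r ltr_pdivlMr // -{1}(gtr0_norm Mp) -normrM.
have trb c : M.+1%:R * fr c j < M.+1%:R by rewrite gtr_pMr.
have tr0 c : 0 <= M.+1%:R * fr c j by rewrite mulr_ge0 // ltW.
have trlt c : (Num.trunc (M.+1%:R * fr c j) < M.+1)%N.
  by rewrite truncn_lt_nat.
have e : Num.trunc (M.+1%:R * fr a j) = Num.trunc (M.+1%:R * fr b j).
  have := congr1 (fun f : {ffun J -> 'I_M.+1} => val (f j)) boxab.
  by rewrite !ffunE /= !inordK.
have := truncn_itv (tr0 a); rewrite e -[(Num.trunc _).+1%:R]natr1 => /andP[a1 a2].
have := truncn_itv (tr0 b); rewrite -[(Num.trunc _).+1%:R]natr1 => /andP[b1 b2].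
rewrite mulrC mulrBr ltr_norml.
by apply/andP; split; lra.
Qed.

Lemma small_int (z : int) : `|z%:~R : R| < 1 -> z = 0.
Proof.
by rewrite -intr_norm -[1]/(1%:~R) ltr_int -[_ < 1]/(_ < 0 + 1) ltzD1 normr_le0 => /eqP.
Qed.

(** Multiply the flow by q and round to nearby integers. When the rounding error
is below 1/(|K|+1), the two sides of a conservation law at a vertex, which
involves |K|+1 terms, are integers at distance less than 1, hence equal; in the
same way null weights stay null and the total mass is exactly q. *)
Lemma integral_flow (I K : finType) (w : I -> K -> K -> R) (m : K -> R) :
  (forall i p q, 0 <= w i p q) ->
  (forall i p, \sum_q w i p q = m p) ->
  (forall i q, \sum_p w i p q = m q) ->
  \sum_p m p = 1 ->
  exists (N : I -> K -> K -> nat) (n : K -> nat),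
    [/\ forall i p, (\sum_q N i p q)%N = n p,
        forall i q, (\sum_p N i p q)%N = n q,
        forall i p q, (0 < N i p q)%N -> 0 < w i p q
      & exists p, (0 < n p)%N].
Proof.
move=> w0 wr wc m1.
pose u (j : K + (I * K * K)) := match j with
  inl p => m p | inr (i, p, q) => w i p q end.
have [q [n [q0 nP]]] := simultaneous_approximation u (ltn0Sn #|K|).
pose nm p := n (inl p); pose nw i p r := n (inr (i, p, r)).
have Kp : 0 < #|K|.+1%:R :> R by rewrite ltr0n.
have inv1 : (#|K|.+1%:R)^-1 <= 1 :> R.
  by rewrite invf_le1 // ler1n.
have sumle (f : K -> R) : (forall k, `|f k| < (#|K|.+1%:R)^-1) ->
    `|\sum_k f k| <= #|K|%:R * (#|K|.+1%:R)^-1.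
  move=> fk; apply: le_trans (ler_norm_sum _ _ _) _.
  rewrite mulr_natl -sumr_const; apply: ler_sum => k _; exact/ltW.
have tot : (#|K|%:R + 1) * (#|K|.+1%:R)^-1 = 1 :> R.
  by rewrite natr1 divff // lt0r_neq0.
have invp : 0 < (#|K|.+1%:R)^-1 :> R by rewrite invr_gt0.
have sum_eq (f : K -> R) (g : K -> int) p :
    (forall k, `|q%:R * f k - (g k)%:~R| < (#|K|.+1%:R)^-1) ->
    \sum_k f k = m p -> \sum_k g k = nm p.
  move=> fg fm; apply/eqP; rewrite -subr_eq0; apply/eqP/small_int.
  rewrite intrB rmorph_sum /=.
  have -> : \sum_k (g k)%:~R - (nm p)%:~R =
      (q%:R * m p - (nm p)%:~R) - \sum_k (q%:R * f k - (g k)%:~R) :> R.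
    rewrite sumrB -mulr_sumr fm; lra.
  apply: le_lt_trans (ler_normB _ _) _.
  have := nP (inl p); have := sumle _ fg; rewrite /= -/(nm p) => h1 h2.
  rewrite -[ltRHS]tot mulrDl mul1r addrC; exact: ler_ltD h1 h2.
have nw0 i p r : 0 <= nw i p r.
  rewrite -[_ <= _]/(0 <= (nw i p r)) -ltzD1 -(ltr_int R) intrD.
  have := nP (inr (i, p, r)); rewrite ltr_norml /= -/(nw i p r) => /andP[_ h].
  have : 0 <= q%:R * w i p r by rewrite mulr_ge0 // ler0n.
  rewrite mulr0z mulr1z => h2; have {h} h := lt_le_trans h inv1; lra.
have rows i p : \sum_r nw i p r = nm p.
  by apply: (sum_eq (w i p)) => [k|]; [exact: (nP (inr (i, p, k)))|exact: wr].
have cols i p : \sum_r nw i r p = nm p.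
  by apply: (sum_eq (w i ^~ p)) => [k|]; [exact: (nP (inr (i, k, p)))|exact: wc].
have summ : \sum_p nm p = q%:Z.
  apply/eqP; rewrite -subr_eq0; apply/eqP/small_int.
  rewrite intrB rmorph_sum /=.
  have -> : \sum_k (nm k)%:~R - q%:Z%:~R = - \sum_k (q%:R * m k - (nm k)%:~R) :> R.
    rewrite sumrB -mulr_sumr m1 -pmulrn; lra.
  rewrite normrN; have := sumle _ (fun k => nP (inl k)) => h.
  by rewrite -[ltRHS]tot mulrDl mul1r; apply: le_lt_trans h _; rewrite ltrDl.
have absz_sum (f : K -> int) : (forall k, 0 <= f k) ->
    (\sum_k absz (f k))%N = absz (\sum_k f k).
  move=> f0; apply/eqP; rewrite -eqz_nat gez0_abs ?sumr_ge0 // -natz natr_sum.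
  by apply/eqP/eq_bigr => k _; rewrite natz gez0_abs.
exists (fun i p r => `|nw i p r|%N), (fun p => `|nm p|%N); split.
- by move=> i p; rewrite absz_sum ?rows.
- by move=> i p; rewrite absz_sum ?cols.
- move=> i p r; rewrite absz_gt0 => nz; rewrite lt_neqAle w0 andbT.
  apply/negP => /eqP wz; move/eqP: nz; apply; apply: small_int.
  have := nP (inr (i, p, r)); rewrite /= -wz mulr0 sub0r normrN => h.
  exact: lt_le_trans h inv1.
- apply/not_existsP => H.
  have : \sum_p nm p = 0.
    rewrite big1 // => p _; apply/eqP; rewrite -absz_eq0 -leqn0 leqNgt; apply/negP; exact: H.
  by rewrite summ => -[q00]; rewrite q00 in q0.
Qed.

End Approximation.

(** Match the fibers over each point of K through their enumerations. *)
Lemma fiberwise_bijection (X Y K : finType) (f : X -> K) (g : Y -> K) :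
  (forall k, #|[pred x | f x == k]| = #|[pred y | g y == k]|) ->
  exists2 h : X -> Y, bijective h & forall x, g (h x) = f x.
Proof.
move=> cfg; pose A k := enum [pred x | f x == k]; pose B k := enum [pred y | g y == k].
have sAB k : size (A k) = size (B k) by rewrite -!cardE cfg.
have inA x : x \in A (f x) by rewrite mem_enum inE.
have idx x : (index x (A (f x)) < size (B (f x)))%N by rewrite -sAB index_mem.
have y0 (x : X) : Y.
  by case: (B (f x)) (idx x) => [|y l _]; [rewrite /= ltn0|exact: y].
pose h x := nth (y0 x) (B (f x)) (index x (A (f x))).
have gh x : g (h x) = f x.
  by have := mem_nth (y0 x) (idx x); rewrite mem_enum inE => /eqP.
have hinj : injective h.
  move=> x x' e; have ef : f x = f x' by rewrite -!gh e.
  have uB k : uniq (B k) by exact: enum_uniq.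
  have e2 : index x (A (f x)) = index x' (A (f x)).
    apply/eqP; rewrite -(nth_uniq (y0 x) (idx x) _ (uB (f x))); last by rewrite ef idx.
    by apply/eqP; move: e; rewrite /h -ef (set_nth_default (y0 x)) // ef idx.
  by rewrite -(nth_index x (inA x)) e2 nth_index // ef.
exists h => //; apply: inj_card_bij => //.
rewrite -[#|X|]sum1_card -[#|Y|]sum1_card.
rewrite (partition_big g predT) //= (partition_big f predT) //=.
by apply: eq_leq; apply: eq_bigr => k _; rewrite !sum1_card; exact/esym/cfg.
Qed.

Lemma measure_fibers (R : realType) d (T : measurableType d)
    (mu : probability T R) (K : finType) (k : T -> K) (A : set T) :
  measurable A -> (forall p, measurable (k @^-1` [set p])) ->
  (mu A = \sum_(p : K) mu (A `&` k @^-1` [set p]))%E.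
Proof.
move=> mA mk; transitivity (mu (\bigcup_(p in [set: K]) (A `&` k @^-1` [set p]))).
  congr (mu _); rewrite -setI_bigcupr; apply/seteqP; split=> x.
    by move=> Ax; split => //; exists (k x).
  by case.
rewrite measure_fin_bigcup //.
- rewrite [RHS]fsbig_seq ?index_enum_uniq //; apply: eq_fsbigl.
  by apply/seteqP; split=> // p _; exact: mem_index_enum.
- exact: finite_finset.
- by move=> i j _ _ [x [[_ <-] [_ <-]]].
- by move=> i _; apply: measurableI.
Qed.

(** Each vertex p is replaced by n p points, and for each i the points over p are
paired with the N i p q edges leaving p for the various q; the edges entering a
vertex are paired with the points over it too, so following the edges is a
permutation. *)
Lemma finite_flow_model (R : realType) d (T : measurableType d)
    (mu : probability T R) (I K : finType) (tau : I -> T -> T) (k : T -> K) :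
  (forall p, measurable (k @^-1` [set p])) ->
  (forall i B, measurable B ->
     measurable (tau i @^-1` B) /\ mu (tau i @^-1` B) = mu B) ->
  exists (V : finType) (v0 : V) (s : I -> V -> V) (kap : V -> K),
    (forall i, bijective (s i)) /\
    forall i v, exists t, k t = kap v /\ k (tau i t) = kap (s i v).
Proof.
move=> mk mtau.
pose fib p := k @^-1` [set p].
have mtk i q : measurable (tau i @^-1` fib q) by have [] := mtau i _ (mk q).
have fin A : measurable A -> mu A \is a fin_num by exact: fin_num_measure.
pose w i p q : R := fine (mu (fib p `&` tau i @^-1` fib q)).
pose m p : R := fine (mu (fib p)).
have [||||N [n [Nr Nc Nw [p0 np0]]]] := @integral_flow R I K w m.
- by move=> i p q; exact: fine_ge0.
- move=> i p; apply: EFin_inj; rewrite -sumEFin /m fineK ?fin //; last exact: mk.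
  rewrite [RHS](@measure_fibers _ _ _ mu K (k \o tau i) _ (mk p) (mtk i)).
  by apply: eq_bigr => q _; rewrite /w fineK // fin //; apply: measurableI; [exact: mk|exact: mtk].
- move=> i q; apply: EFin_inj; rewrite -sumEFin /m fineK ?fin //; last exact: mk.
  have [_ <-] := mtau i _ (mk q).
  rewrite [RHS](@measure_fibers _ _ _ mu K k _ (mtk i q)) //.
  apply: eq_bigr => p _; rewrite /w fineK; first by rewrite setIC.
  by rewrite fin //; apply: measurableI; [exact: mk|exact: mtk].
- apply: EFin_inj; rewrite -sumEFin -(@probability_setT _ _ _ mu).
  rewrite [RHS](@measure_fibers _ _ _ mu K k _ measurableT) //.
  by apply: eq_bigr => p _; rewrite /m fineK ?setTI // fin //; exact: mk.
pose V : finType := {p : K & 'I_(n p)}.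
pose E i : finType := {pq : K * K & 'I_(N i pq.1 pq.2)}.
have cV p : #|[pred v : V | tag v == p]| = n p.
  rewrite -sum1_card.
  transitivity (\sum_(q | q == p) \sum_(j : 'I_(n q)) 1)%N.
    rewrite (@sig_big_dep _ _ _ _ (fun q => 'I_(n q)) (pred1 p) (fun _ => predT) (fun _ _ => 1%N)) /=.
    by apply: eq_bigl => v; rewrite inE andbT.
  by rewrite big_pred1_eq sum1_card card_ord.
have cE i (P : pred (K * K)) :
    #|[pred e : E i | P (tag e)]| = (\sum_(pq | P pq) N i pq.1 pq.2)%N.
  rewrite -sum1_card.
  transitivity (\sum_(pq | P pq) \sum_(j : 'I_(N i pq.1 pq.2)) 1)%N.
    rewrite (@sig_big_dep _ _ _ _ (fun pq => 'I_(N i pq.1 pq.2)) P (fun _ => predT) (fun _ _ => 1%N)) /=.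
    by apply: eq_bigl => v; rewrite inE andbT.
  by apply: eq_bigr => pq _; rewrite sum1_card card_ord.
have src i : exists2 h : E i -> V, bijective h & forall e, tag (h e) = (tag e).1.
  apply: (@fiberwise_bijection _ _ _ (fun e : E i => (tag e).1) (fun v : V => tag v)) => p.
  rewrite cV (cE i (fun pq => pq.1 == p)) -(Nr i p).
  transitivity (\sum_(p' | p' == p) \sum_q N i p' q)%N; last by rewrite big_pred1_eq.
  by rewrite pair_big /=; apply: eq_bigl => pq; rewrite andbT.
have tgt i : exists2 h : E i -> V, bijective h & forall e, tag (h e) = (tag e).2.
  apply: (@fiberwise_bijection _ _ _ (fun e : E i => (tag e).2) (fun v : V => tag v)) => q.
  rewrite cV (cE i (fun pq => pq.2 == q)) -(Nc i q).
  transitivity (\sum_p \sum_(q' | q' == q) N i p q')%N.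
    by rewrite pair_big.
  by apply: eq_bigr => p _; rewrite big_pred1_eq.
have step i : exists2 s : V -> V, bijective s &
    forall v, exists t, k t = tag v /\ k (tau i t) = tag (s v).
  have [a [a' aK a'K] sa] := src i; have [b bb tb] := tgt i.
  exists (b \o a'); first by apply: bij_comp bb _; exists a.
  move=> v /=; rewrite tb -{1}(a'K v) sa.
  case: (a' v) => [[p q] j] /=.
  have /Nw : (0 < N i p q)%N by apply: leq_ltn_trans (ltn_ord j).
  rewrite /w => h.
  have : fib p `&` tau i @^-1` fib q !=set0.
    by apply/set0P/eqP => e; move: h; rewrite e measure0 /= ltxx.
  by case=> t [kp kq]; exists t.
exists V, (Tagged (fun p => 'I_(n p)) (Ordinal np0)).
exists (fun i => projT1 (cid2 (step i))), (fun v => tag v).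
by split=> i; case: (cid2 (step i)).
Qed.

(** * Cantor space and locally constant maps *)

(** The form in which compactness is used throughout: a monotone family of
properties, each point having one of them in a neighbourhood. *)
Lemma compact_uniform (T : topologicalType) (K : set T) (Q : nat -> T -> Prop) :
  compact K -> (forall n m x, (n <= m)%N -> Q n x -> Q m x) ->
  (forall x, K x -> exists n, \forall y \near x, Q n y) ->
  exists n, forall x, K x -> Q n x.
Proof.
move=> /compact_near_coveringP cK Qmon Qx.
have [n _ nP] : \forall n \near \oo, K `<=` Q n.
  apply: cK => x /Qx[n nQ]; exists ([set y | Q n y], [set m | (n <= m)%N]).
    by split=> //=; exists n.
  by case=> y m /= [Qny nm]; exact: Qmon nm Qny.
by exists n; exact: (nP n (leqnn n)).
Qed.

Lemma prod_nbhs_base (I : eqType) (T : I -> topologicalType)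
    (f : prod_topology T) (U : set (prod_topology T)) : nbhs f U ->
  exists (W : seq I) (V : forall i, set (T i)),
    (forall i, nbhs (f i) (V i)) /\
    forall f' : prod_topology T, (forall i, i \in W -> V i (f' i)) -> U f'.
Proof.
pose B : set (seq I * (forall i, set (T i))) :=
  [set WV | forall i, nbhs (f i) (WV.2 i)].
pose S (WV : seq I * (forall i, set (T i))) : set (prod_topology T) :=
  [set f' | forall i, i \in WV.1 -> WV.2 i (f' i)].
have FG : Filter (filter_from B S).
  apply: filter_from_filter; first by exists ([::], fun _ => setT) => i; exact: filterT.
  move=> [W V] [W' V'] BV BV'; exists (W ++ W', fun i => V i `&` V' i).
    by move=> i; apply: filterI; [exact: BV|exact: BV'].
  by move=> g gP; split=> i iW; have [] := gP i; rewrite ?mem_cat ?iW ?orbT.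
have : filter_from B S --> f.
  apply/cvg_sup => i A [_ [[A' oA <-] Af sA]].
  exists ([:: i], dfwith (fun i => setT) i A').
    move=> j /=; case: dfwithP => [|k _]; last exact: filterT.
    exact: open_nbhs_nbhs.
  move=> g /= /(_ i); rewrite mem_head => /(_ isT) /=; rewrite dfwithin; exact: sA.
by move=> /(_ U) Uf /Uf [[W V] BV SU]; exists W, V.
Qed.

Lemma prod_nbhs_coord (I : eqType) (T : I -> topologicalType)
    (f : prod_topology T) (i : I) (A : set (T i)) :
  nbhs (f i) A -> \forall g \near f, A (g i).
Proof. by move=> fA; exact: (@proj_continuous I T i f A fA). Qed.

(** Agreement on the first n coordinates describes the topology, the uniformity
and, through them, the uniform convergence of homeomorphisms, so that it
replaces a metric below. *)
Definition agree (n : nat) (x y : cantor_space) : Prop :=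
  forall i, (i < n)%N -> x i = y i.

Lemma agree_sym n x y : agree n x y -> agree n y x.
Proof. by move=> e i /e. Qed.

Lemma agree_trans n x y z : agree n x y -> agree n y z -> agree n x z.
Proof. by move=> e1 e2 i ni; rewrite e1 // e2. Qed.

Lemma agreeW m n x y : (n <= m)%N -> agree m x y -> agree n x y.
Proof. by move=> nm e i ni; apply: e; exact: leq_trans nm. Qed.

Lemma agree_eq x y : (forall n, agree n x y) -> x = y.
Proof. by move=> e; apply/funext => i; exact: (e i.+1). Qed.

Lemma agree_nbhs n (x : cantor_space) : \forall y \near x, agree n x y.
Proof.
elim: n => [|n IH]; first by near=> y => i; rewrite ltn0.
near=> y => i; rewrite ltnS leq_eqVlt => /predU1P[->|ni]; last first.
  by have : agree n x y by [near: y]; apply.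
near: y; apply: (@prod_nbhs_coord nat (fun _ => bool) x n [set b | x n = b]).
by apply: open_nbhs_nbhs; split => //; exact: discrete_open.
Unshelve. all: by end_near. Qed.

Lemma nbhs_agree (x : cantor_space) U :
  nbhs x U -> exists n, forall y, agree n x y -> U y.
Proof.
move=> /prod_nbhs_base[W [V [xV VU]]].
exists (\max_(i <- W) i).+1 => y xy; apply: VU => i iW.
rewrite -xy; first exact: nbhs_singleton.
by rewrite ltnS; exact: leq_bigmax_seq.
Qed.

Lemma cantor_uniform (Q : nat -> cantor_space -> Prop) :
  (forall n m x, (n <= m)%N -> Q n x -> Q m x) ->
  (forall x, exists n, forall y, agree n x y -> Q n y) ->
  exists n, forall x, Q n x.
Proof.
move=> Qmon Qx; have [|n nP] := compact_uniform cantor_space_compact Qmon.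
  move=> x _; have [n nP] := Qx x; exists n.
  by apply: filterS (agree_nbhs n x) => y; exact: nP.
by exists n => x; exact: nP.
Qed.

(** Continuity into the discrete space K, for an arbitrary type K that carries no
topology. *)
Definition locally_constant (T : topologicalType) (K : Type) (c : T -> K) :=
  forall x, \forall y \near x, c y = c x.

Lemma locally_constant_uniform (K : Type) (c : cantor_space -> K) :
  locally_constant c -> exists n, forall x y, agree n x y -> c x = c y.
Proof.
move=> lc; have [||n nP] :=
    @cantor_uniform (fun n x => forall y, agree n x y -> c x = c y).
- by move=> n m x nm H y /(agreeW nm)/H.
- move=> x; have [n nP] := nbhs_agree (lc x); exists n => y xy z yz.
  by rewrite !nP //; exact: agree_trans yz.
- by exists n.
Qed.

Lemma locally_constant_comp (T U : topologicalType) (K : Type) (f : T -> U)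
  (c : U -> K) : continuous f -> locally_constant c -> locally_constant (c \o f).
Proof. by move=> cf lc x; exact: cf (lc (f x)). Qed.

Lemma locally_constantS (T : topologicalType) (K L : Type) (c : T -> K)
  (f : K -> L) : locally_constant c -> locally_constant (f \o c).
Proof. by move=> lc x; apply: filterS (lc x) => y /= ->. Qed.

Lemma locally_constant_open (T : topologicalType) (K : Type) (c : T -> K) A :
  locally_constant c -> open (c @^-1` A).
Proof.
move=> lc; rewrite openE => x /= Ax; rewrite /interior.
by apply: filterS (lc x) => y /= ->.
Qed.

Lemma locally_constant_closed (T : topologicalType) (K : Type) (c : T -> K) A :
  locally_constant c -> closed (c @^-1` A).
Proof.
move=> lc; rewrite -[c @^-1` A]setCK preimage_setC; apply: open_closedC.
exact: locally_constant_open.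
Qed.

Definition trunc (n : nat) (x : cantor_space) : {ffun 'I_n -> bool} :=
  [ffun i => x (val i)].

Lemma truncP n x y : trunc n x = trunc n y <-> agree n x y.
Proof.
split=> [/ffunP e i ni|e]; first by have := e (Ordinal ni); rewrite !ffunE.
by apply/ffunP => i; rewrite !ffunE; apply: e; exact: ltn_ord.
Qed.

Lemma trunc_locally_constant n : locally_constant (trunc n).
Proof. by move=> x; apply: filterS (agree_nbhs n x) => y /agree_sym/truncP. Qed.

Lemma continuous_agree (f : cantor_space -> cantor_space) (n : nat) :
  continuous f -> exists m, forall x y, agree m x y -> agree n (f x) (f y).
Proof.
move=> cf; have [m mP] := locally_constant_uniform
  (locally_constant_comp cf (trunc_locally_constant n)).
by exists m => x y /mP/truncP.
Qed.

Lemma agree_continuous (f : cantor_space -> cantor_space) :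
  (forall n, exists m, forall x y, agree m x y -> agree n (f x) (f y)) ->
  continuous f.
Proof.
move=> H x U /nbhs_agree[n nU]; have [m mP] := H n.
by apply: filterS (agree_nbhs m x) => y /mP/nU.
Qed.

Lemma entourage_agree (E : set (cantor_space * cantor_space)) :
  entourage E -> exists n, forall x y, agree n x y -> E (x, y).
Proof.
(* Two points near x are close to x, hence to each other. *)
move=> eE; have eS := entourage_split_ent eE.
have [||n nP] :=
    @cantor_uniform (fun n x => forall y, agree n x y -> E (x, y)).
- by move=> n m x nm H y /(agreeW nm)/H.
- move=> x; have nx : nbhs x (xsection (split_ent E) x) by exact: nbhs_entourage.
  have nx' : nbhs x (xsection ((split_ent E)^-1)%relation x).
    by apply: nbhs_entourage; exact: entourage_inv.
  have [n nP] := nbhs_agree (filterI nx nx'); exists n => y xy z yz.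
  have [_ /xsectionP h1] := nP _ xy.
  have [/xsectionP h2 _] := nP _ (agree_trans xy yz).
  by apply: (@entourage_split _ x) => //.
- by exists n.
Qed.

(** In a compact space every neighbourhood of the diagonal is an entourage; the
filter of small entourages makes near-covering compactness applicable. *)
Lemma agree_entourage n :
  entourage [set xy : cantor_space * cantor_space | agree n xy.1 xy.2].
Proof.
pose P (E : set (cantor_space * cantor_space)) x :=
  forall y, E (x, y) -> agree n x y.
have [E eE EP] : exists2 E, entourage E & forall x, P E x.
  have : \forall E \near powerset_filter_from (@entourage cantor_space),
      [set: cantor_space] `<=` P E.
    have /compact_near_coveringP cov := cantor_space_compact.
    apply: cov => x _.
    have /nbhsP[E0 eE0 E0P] := agree_nbhs n x.
    have eS := entourage_split_ent eE0.
    exists (xsection (split_ent E0) x, [set E | entourage E /\ E `<=` split_ent E0]).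
      split=> /=; first exact: nbhs_entourage.
      exact: powerset_filter_fromP.
    move=> [x' E] /= [/xsectionP xx' [_ EE0]] y /EE0 x'y.
    have a1 : agree n x x'.
      by apply: E0P; apply/xsectionP; exact: split_ent_subset.
    apply: agree_trans (agree_sym a1) _; apply: E0P; apply/xsectionP.
    exact: entourage_split x'y.
  move=> [M [M1 _ [E ME]] MP]; exists E; first exact: M1.
  by move=> x; exact: MP.
by apply: filterS eE => -[x y] /EP.
Qed.

Lemma homeo_nbhs_agree (f : Homeo) U : nbhs f U ->
  exists n, forall f' : Homeo, (forall x, agree n (f x) (f' x)) -> U f'.
Proof.
move=> [_ [[A oA <-] Af sA]].
have : nbhs (val f : {uniform cantor_space -> cantor_space}) A.
  exact: open_nbhs_nbhs.
move/uniform_nbhs => [E [/entourage_agree[n nE] EA]].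
exists n => f' ff'; apply: sA; apply: EA => x _.
exact: nE (ff' x).
Qed.

Lemma homeo_agree_nbhs (f : Homeo) n :
  nbhs f [set f' : Homeo | forall x, agree n (f x) (f' x)].
Proof.
have : nbhs (val f : {uniform cantor_space -> cantor_space})
    [set h : cantor_space -> cantor_space | forall x, agree n (homeo_fun f x) (h x)].
  apply/uniform_nbhs; exists [set xy | agree n xy.1 xy.2].
  by split; [exact: agree_entourage|move=> h H x; exact: H].
by move=> h; exact: (@initial_continuous _ _ (fun g : Homeo => val g) f _ h).
Qed.

(** * Clopen partitions of Cantor space *)

Lemma separated_hausdorff (T : topologicalType) :
  (forall x y : T, x <> y ->
     exists2 c : T -> bool, locally_constant c & c x <> c y) ->
  hausdorff_space T.
Proof.
move=> sep x y xy; apply: contrapT => /sep[c lc cxy].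
have [z [/= e1 e2]] := xy _ _ (lc x) (lc y).
by apply: cxy; rewrite -e1 e2.
Qed.

Lemma set_type_compact (X : topologicalType) (A : set X) :
  compact A -> compact [set: A].
Proof.
move=> cA F FF _.
have AF : ((val : A -> X) @ F) A.
  have h : (val : A -> X) @^-1` A = setT.
    by apply/seteqP; split=> // -[x xA] _; exact: set_mem xA.
  by rewrite /nbhs /= /fmap h; exact: filterT.
have [x [Ax xF]] := cA ((val : A -> X) @ F) (fmap_proper_filter _ FF) AF.
exists (SigSub (mem_set Ax)); split=> // B C FB [_ [[D oD <-] /= Dx DC]].
have [|y [[b Bb <-] Db]] := xF ((fun a : A => val a) @` B) D _ (open_nbhs_nbhs (conj oD Dx)).
  by apply: (@filterS _ F _ B) FB => b Bb; exists b.
by exists b; split => //; exact: DC.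
Qed.

Section CantorSubspace.
Variables (R : realType) (Z : set (prod_topology (fun _ : nat => bool))).
Variable z0 : Z.

Let T : pseudoMetricType R := Z.
Let PT : pseudoPMetricType R := HB.pack T (isPointed.Build T z0).

Let coord_locally_constant i : locally_constant (fun z : T => val z i).
Proof.
apply: (@locally_constant_comp _ _ _ (fun z : T => val z) (fun z : cantor_space => z i)).
  exact: initial_continuous.
by move=> z; apply: filterS (agree_nbhs i.+1 z) => z' /(_ i (ltnSn i)).
Qed.

Let coord_separates (x y : T) : x <> y -> exists i, val x i <> val y i.
Proof.
move=> xy; apply/existsNP => e; apply: xy; apply: val_inj.
by apply/funext => i; exact: e.
Qed.

(** A closed subset without isolated points satisfies the topological
characterization of Cantor space, since coordinates separate its points. *)
Lemma cantor_subspace_homeo : closed Z ->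
  (forall x n, Z x -> exists y, [/\ Z y, y <> x & agree n x y]) ->
  exists f : cantor_space -> T,
    [/\ continuous f, injective f & range f = setT].
Proof.
move=> cZ pZ.
have cT : cantor_like T.
  split.
  - apply/perfectTP => x [A oA Ax].
    have /(nbhs_agree (x := val x))[n nA] : nbhs (val x) A.
      apply: open_nbhs_nbhs; split=> //.
      by have : [set x] x by []; rewrite -Ax.
    have [y [Zy yx /nA Ay]] := pZ (val x) n (set_mem (valP x)).
    have : [set x] (SigSub (mem_set Zy)) by rewrite -Ax.
    by move=> /(congr1 val) /= /yx.
  - apply: set_type_compact; apply: subclosed_compact cZ cantor_space_compact _.
    by [].
  - by apply: separated_hausdorff => x y /coord_separates[i xyi];
      exists (fun z : T => val z i).
  - move=> x y /eqP/coord_separates[i xyi].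
    exists ((fun z : T => val z i) @^-1` [set val x i]); split=> //.
      by split; [exact: locally_constant_open|exact: locally_constant_closed].
    by move=> /= e; exact: xyi.
have [f [cf _]] := @homeomorphism_cantor_like R PT cT.
exists f; split=> //.
have fs y : exists x, f x = y by have [x _ <-] := @surj _ _ _ _ f y I; exists x.
by apply: (iffRL (@seteqP Z _ _)); split=> // y _; have [x <-] := fs y; exists x.
Qed.

End CantorSubspace.

Lemma cantor_embedding (R : realType) (Z : set cantor_space) : closed Z -> Z !=set0 ->
  (forall x n, Z x -> exists y, [/\ Z y, y <> x & agree n x y]) ->
  exists f : cantor_space -> cantor_space,
    [/\ continuous f, injective f & range f = Z].
Proof.
move=> cZ [z0 Zz0] pZ.
have [f [cf fi fs]] := @cantor_subspace_homeo R Z (SigSub (mem_set Zz0)) cZ pZ.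
exists (fun x => val (f x)); split.
- move=> x; apply: (@continuous_comp _ _ _ f (fun z : Z => val z)); first exact: cf.
  exact: initial_continuous.
- by move=> x y /val_inj/fi.
- apply/seteqP; split=> [_ [x _ <-]|z Zz]; first exact: set_mem (valP (f x)).
  have : range f (SigSub (mem_set Zz)) by rewrite fs.
  by case=> x _ e; exists x => //; rewrite e.
Qed.

Lemma continuous_image_closed (X Y : topologicalType) (f : X -> Y) (C : set X) :
  compact [set: X] -> hausdorff_space Y -> continuous f -> closed C ->
  closed (f @` C).
Proof.
move=> cX hY cf cC; apply: compact_closed => //.
apply: continuous_compact; first exact: continuous_subspaceT.
exact: subclosed_compact cC cX _.
Qed.

Lemma continuous_bijection_homeo (X Y : topologicalType) (f : X -> Y) :
  compact [set: X] -> hausdorff_space Y -> continuous f -> bijective f ->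
  homeomorphism f.
Proof.
move=> cX hY cf [g fK gK]; split=> //; exists g; split=> //.
apply/continuous_closedP => C cC.
have -> : g @^-1` C = f @` C.
  apply/seteqP; split=> [y Cy|_ [x Cx <-]]; last by rewrite /= fK.
  by exists (g y).
exact: continuous_image_closed.
Qed.

Lemma cantor_closed_agree (Z : set cantor_space) :
  (forall x, (forall n, exists2 y, Z y & agree n x y) -> Z x) -> closed Z.
Proof.
move=> H x clx; apply: H => n.
by have [y [Zy xy]] := clx _ (agree_nbhs n x); exists y.
Qed.

(** The nonempty fibers of c and of c' are clopen without isolated points, hence
all copies of Cantor space; the homeomorphism is assembled fiber by fiber. *)
Lemma cantor_fiber_homeo (R : realType) (K : finType) (c c' : cantor_space -> K) :
  locally_constant c -> locally_constant c' -> range c = range c' ->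
  exists h : Homeo, forall x, c (h x) = c' x.
Proof.
move=> lc lc' rcc'.
have param (b : cantor_space -> K) k : locally_constant b -> range b k ->
    exists f : cantor_space -> cantor_space,
      [/\ continuous f, injective f & range f = b @^-1` [set k]].
  move=> lb [x0 _ bx0]; apply: (cantor_embedding R).
  - exact: locally_constant_closed.
  - by exists x0.
  - move=> x n /= bx; have [m mP] := locally_constant_uniform lb.
    (* Changing one far coordinate stays in the fiber. *)
    pose y : cantor_space := fun i => if i == maxn n m then ~~ x i else x i.
    have xy : agree (maxn n m) x y.
      by move=> i imn; rewrite /y ltn_eqF.
    exists y; split.
    + by rewrite /= -bx; apply/esym/mP/(agreeW _ xy); exact: leq_maxr.
    + by move=> /(congr1 (fun z => z (maxn n m))); rewrite /y eqxx; case: (x _).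
    + exact: agreeW (leq_maxl _ _) xy.
have pf k : {f : cantor_space -> cantor_space | range c k ->
    [/\ continuous f, injective f & range f = c @^-1` [set k]]}.
  apply: cid; have [/param[//|f fP]|nk] := pselect (range c k); last by exists id.
  by exists f.
have pg k : {f : cantor_space -> cantor_space | range c k ->
    [/\ continuous f, injective f & range f = c' @^-1` [set k]]}.
  apply: cid; have [|nk] := pselect (range c k); last by exists id.
  by rewrite {1}rcc' => /param[//|f fP]; exists f.
pose f k := projT1 (pf k); pose g k := projT1 (pg k).
have fP k : range c k -> [/\ continuous (f k), injective (f k) & range (f k) = c @^-1` [set k]].
  exact: (projT2 (pf k)).
have gP k : range c k -> [/\ continuous (g k), injective (g k) & range (g k) = c' @^-1` [set k]].
  exact: (projT2 (pg k)).
have rc x : range c (c' x) by rewrite rcc'; exists x.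
have gx x : exists y, g (c' x) y = x.
  have [_ _ rg] := gP _ (rc x).
  have : range (g (c' x)) x by rewrite rg.
  by case=> y _; exists y.
pose h x := f (c' x) (projT1 (cid (gx x))).
have gh x : g (c' x) (projT1 (cid (gx x))) = x by exact: projT2 (cid (gx x)).
have ch x : c (h x) = c' x.
  have [_ _ rf] := fP _ (rc x).
  have : range (f (c' x)) (h x) by eexists.
  by rewrite rf.
have hg k y : range c k -> h (g k y) = f k y.
  move=> rk; have [_ gi rg] := gP _ rk.
  have e : c' (g k y) = k.
    have : range (g k) (g k y) by eexists.
    by rewrite rg.
  have := gh (g k y); rewrite /h; move: (projT1 (cid (gx (g k y)))) => z.
  by rewrite e => /gi ->.
have hinj : injective h.
  move=> x y e; have e' : c' x = c' y by rewrite -!ch e.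
  have [_ fi _] := fP _ (rc y).
  move: (gh x) (gh y) e; rewrite /h.
  move: (projT1 (cid (gx x))) (projT1 (cid (gx y))) => u v.
  by rewrite e' => gu gv /fi uv; rewrite -gu uv.
have hsurj z : exists x, h x = z.
  have rz : range c (c z) by exists z.
  have [_ _ rf] := fP _ rz.
  have : range (f (c z)) z by rewrite rf.
  by case=> y _ <-; exists (g (c z) y); exact: hg.
have hbij : bijective h.
  exists (fun z => projT1 (cid (hsurj z))) => x; last exact: projT2 (cid (hsurj x)).
  by apply: hinj; exact: projT2 (cid (hsurj (h x))).
have hcont : continuous h.
  apply/continuous_closedP => C cC.
  have -> : h @^-1` C = \bigcup_(k in range c) (g k @` (f k @^-1` C)).
    apply/seteqP; split=> [x /= Chx|_ [k rk [y Cy <-]]] /=; last by rewrite hg.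
    by exists (c' x) => //; exists (projT1 (cid (gx x))).
  apply: closed_bigcup; first exact: finite_finset.
  move=> k rk; have [cf _ _] := fP _ rk; have [cg _ _] := gP _ rk.
  apply: continuous_image_closed => //.
  - exact: cantor_space_compact.
  - exact: cantor_space_hausdorff.
  - exact: (iffLR (continuous_closedP _)).
have hh := continuous_bijection_homeo cantor_space_compact cantor_space_hausdorff hcont hbij.
by exists (mk_homeo hh).
Qed.

(** * From finitely additive means to Borel probabilities *)

Section Means.
Local Open Scope ring_scope.
Variable R : realType.

(** All subsets are measured; countable additivity will only be recovered on the
clopen sets. *)
Definition finitely_additive_mean (T : Type) (m : set T -> R) : Prop :=
  [/\ forall A, 0 <= m A,
      forall A B, A `&` B = set0 -> m (A `|` B) = m A + m B
    & m setT = 1].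

Lemma mean_le1 (T : Type) (m : set T -> R) A :
  finitely_additive_mean m -> m A <= 1.
Proof.
move=> [m0 mU <-]; rewrite -(setUv A) mU ?setICr // lerDl; exact: m0.
Qed.

Lemma mean_set0 (T : Type) (m : set T -> R) :
  finitely_additive_mean m -> m set0 = 0.
Proof.
move=> [_ mU _]; have := mU set0 set0 (set0I _).
by rewrite setU0 -[LHS]addr0 => /addrI.
Qed.

(** Pointwise limit along an ultrafilter, which exists because [0, 1] is compact. *)
Lemma ultralimit_mean (T : Type) (p : nat -> set T -> R) :
  (forall n, finitely_additive_mean (p n)) ->
  exists2 m : set T -> R, finitely_additive_mean m &
    forall A B, (\forall n \near \oo, p n A = p n B) -> m A = m B.
Proof.
move=> pm.
have [U [UU sU]] := @ultraFilterLemma nat \oo _.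
have cvgp A : exists2 l : R, 0 <= l & (fun n => p n A) @ U --> l.
  have UA : ((fun n => p n A) @ U) `[0, 1]%classic.
    apply: (@filterS _ U _ setT) filterT => n _ /=; rewrite in_itv /=.
    by rewrite mean_le1 // andbT; have [+ _ _] := pm n; apply.
  have [l [+ lP]] := @segment_compact R 0 1 _ (fmap_proper_filter _ _) UA.
  rewrite /= in_itv /= => /andP[l0 _]; exists l => // B lB.
  have [//|UB] := in_ultra_setVsetC ((fun n => p n A) @^-1` B) UU.
  by have [y []] := lP (~` B) B UB lB.
pose m A := projT1 (cid2 (cvgp A)).
have m0 A : 0 <= m A by rewrite /m; case: (cid2 (cvgp A)).
have mP A : (fun n => p n A) @ U --> m A by rewrite /m; case: (cid2 (cvgp A)).
have PU : ProperFilter U by exact: ultra_proper.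
have uniq (u v : nat -> R) (a b : R) : (\forall n \near \oo, u n = v n) ->
    u @ U --> a -> v @ U --> b -> a = b.
  move=> uv ua vb; apply: (@cvg_unique R _ (u @ U)) => //.
  by apply: cvg_trans vb; apply: near_eq_cvg; apply: filterS (sU _ uv) => n ->.
exists m; first split => //.
- move=> A B AB; apply: (uniq _ _ _ _ _ (mP _) (cvgD (mP A) (mP B))).
  by near=> n; have [_ + _] := pm n; apply.
- apply: (uniq _ (fun=> 1) _ _ _ (mP _) (cvg_cst _)).
  by near=> n; have [] := pm n.
- by move=> A B /uniq; apply.
Unshelve. all: by end_near. Qed.

(** The uniform measure on the sample points x v, for v satisfying P. *)
Lemma sample_mean (V : finType) (P : pred V) (T : Type) (x : V -> T) (v0 : V) :
  P v0 ->
  finitely_additive_mean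
    (fun A => #|[pred v | P v && `[< A (x v) >]]|%:R / #|P|%:R : R).
Proof.
move=> Pv0; have P0 : (0 < #|P|%:R :> R).
  by rewrite ltr0n; apply/card_gt0P; exists v0.
split.
- by move=> A; rewrite divr_ge0 // ler0n.
- move=> A B AB; rewrite -mulrDl -natrD; congr (_%:R / _).
  rewrite -cardUI [X in (_ = _ + X)%N]eq_card0 ?addn0.
    apply: eq_card => v; rewrite !inE -andb_orr; congr (_ && _).
    by apply/asboolP/orP => -[H|H]; [left|right|left|right]; apply/asboolP.
  move=> v; rewrite !inE; apply/negbTE/negP => /andP[/andP[_ /asboolP Ax]].
  by move=> /andP[_ /asboolP Bx]; have : (A `&` B) (x v) by []; rewrite AB.
- rewrite (@eq_card _ _ P) ?divff ?lt0r_neq0 // => v.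
  by rewrite !inE asboolT ?andbT.
Qed.

End Means.

(** A copy of Cantor space whose measurable sets form the algebra of clopen sets,
so that the extension theorem applies to it. *)
Definition clopen_space : Type := cantor_space.

Definition clopen_display : measure_display.
Proof. by constructor. Qed.

HB.instance Definition _ := Pointed.on clopen_space.

Lemma clopen_set0 : @clopen cantor_space set0.
Proof. by split; [exact: open0|exact: closed0]. Qed.

HB.instance Definition _ := isAlgebraOfSets.Build clopen_display clopen_space
  clopen_set0 (@clopenU cantor_space) (fun C => @clopenC cantor_space C C).

Lemma clopen_level (C : set cantor_space) : clopen C ->
  exists n, forall x y, agree n x y -> C x -> C y.
Proof.
move=> [oC cC].
have lc : locally_constant (fun x => `[< C x >]).
  move=> x; have [Cx|nCx] := pselect (C x).
    apply: filterS (open_nbhs_nbhs (conj oC Cx)) => y Cy.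
    by rewrite !asboolT.
  have oC' : open (~` C) by exact: closed_openC.
  apply: filterS (open_nbhs_nbhs (conj oC' nCx)) => y Cy.
  by rewrite !asboolF.
have [n nP] := locally_constant_uniform lc.
by exists n => x y /nP e /asboolP; rewrite e => /asboolP.
Qed.

Lemma level_clopen n (C : set cantor_space) :
  (forall x y, agree n x y -> C x -> C y) -> clopen C.
Proof.
move=> nC; have -> : C = trunc n @^-1` (trunc n @` C).
  apply/seteqP; split=> x /=; first by exists x.
  by case=> y Cy /truncP/nC; apply.
split; [apply: locally_constant_open|apply: locally_constant_closed];
  exact: trunc_locally_constant.
Qed.

(** An open set is the union over n of the sets of points whose n-cylinder it
contains, and these sets are clopen. *)
Lemma open_borel_clopen : <<s @open cantor_space >> = <<s @clopen cantor_space >>.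
Proof.
apply/seteqP; split.
  apply: smallest_sub; first exact: smallest_sigma_algebra.
  move=> U oU.
  have -> : U = \bigcup_n [set x | forall y, agree n x y -> U y].
    apply/seteqP; split=> [x Ux|x [n _]]; last by apply.
    by have [n nU] := nbhs_agree (open_nbhs_nbhs (conj oU Ux)); exists n.
  apply: (@sigma_algebra_bigcup _ _ (@clopen cantor_space)) => n.
  apply: sub_sigma_algebra; apply: (@level_clopen n) => x y xy H z yz.
  by apply: H; exact: agree_trans yz.
by apply: sub_sigma_algebra2 => C [].
Qed.

Section Extension.
Variables (R : realType) (m : set cantor_space -> R).
Hypothesis mm : finitely_additive_mean m.

Let mE (A : set clopen_space) : \bar R := (m A)%:E.

Let mE0 : mE set0 = 0%E.
Proof. by rewrite /mE mean_set0. Qed.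

Let mE_ge0 A : (0 <= mE A)%E.
Proof. by rewrite lee_fin; have [+ _ _] := mm; apply. Qed.

Let mE_bigsetU (F : nat -> set clopen_space) n : trivIset setT F ->
  mE (\big[setU/set0]_(i < n) F i) = (\sum_(i < n) mE (F i))%E.
Proof.
move=> tF; elim: n => [|n IH]; first by rewrite !big_ord0 mE0.
rewrite !big_ord_recr /= -IH /mE -EFinD; congr (_%:E).
have [_ mU _] := mm; apply: mU.
rewrite -bigcup_mkord -subset0 => x [[i /= ni Fix] Fnx].
have : i = n by apply: tF => //; exists x.
by move=> e; rewrite e ltnn in ni.
Qed.

Let mE_sigma_additive : semi_sigma_additive mE.
Proof.
move=> F mF tF mUF.
have cU : compact (\bigcup_n F n : set cantor_space).
  by apply: subclosed_compact cantor_space_compact _ => //; case: mUF.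
have [||n nP] := @compact_uniform cantor_space _
    (fun n x => exists2 i, (i < n)%N & F i x) cU.
- by move=> n k x nk [i ni Fix]; exists i => //; exact: leq_trans nk.
- move=> x [i _ Fix]; exists i.+1.
  have oF : open (F i : set cantor_space) by have [] := mF i.
  by apply: filterS (open_nbhs_nbhs (conj oF Fix)) => y Fiy; exists i.
apply: cvg_near_cst; exists n => // k /= nk.
rewrite big_mkord -mE_bigsetU //; congr mE.
rewrite -bigcup_mkord; apply/seteqP; split=> x [i ik Fix]; first by exists i.
have [j jn Fjx] := nP x (ex_intro2 _ _ i I Fix).
by exists j => //; exact: leq_trans nk.
Qed.

HB.instance Definition _ := isMeasure.Build clopen_display clopen_space R mE
  mE0 mE_ge0 mE_sigma_additive.

Let mu : set (borel cantor_space) -> \bar R := measure_extension mE.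

Let mu0 : mu set0 = 0%E.
Proof. exact: measure0. Qed.

Let mu_ge0 A : (0 <= mu A)%E.
Proof. exact: measure_ge0. Qed.

Let borelE A : measurable (A : set (borel cantor_space)) ->
  measurable (A : set (g_sigma_algebraType (@measurable _ clopen_space))).
Proof. by move=> mA; rewrite /measurable /= -open_borel_clopen. Qed.

Let mu_sigma_additive : semi_sigma_additive mu.
Proof.
move=> F mF tF mUF.
apply: (@measure_semi_sigma_additive _ _ _ (measure_extension mE)) => //.
by move=> i; exact: borelE.
exact: borelE.
Qed.

HB.instance Definition _ := isMeasure.Build _ (borel cantor_space) R mu
  mu0 mu_ge0 mu_sigma_additive.

Let mu_clopen (C : set cantor_space) : clopen C -> mu C = (m C)%:E.
Proof. by move=> cC; rewrite /mu /measure_extension /= measurable_mu_extE. Qed.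

Let mu_setT : mu setT = 1%E.
Proof.
rewrite mu_clopen; last exact: clopenT.
by have [_ _ ->] := mm.
Qed.

HB.instance Definition _ := Measure_isProbability.Build _ _ R mu mu_setT.

(** On clopen sets a mean is countably additive, because a clopen set that is a
disjoint union of clopen sets is compact, hence a finite union of them. The
Caratheodory extension then lives on the sigma-algebra generated by the clopen
sets, which is that of the Borel sets. *)
Lemma mean_extension : exists mu : probability (borel cantor_space) R,
  forall C : set cantor_space, clopen C -> mu C = (m C)%:E.
Proof. by exists mu; exact: mu_clopen. Qed.

End Extension.

Local Open Scope group_scope.
Local Open Scope classical_set_scope.

(** * Actions of free groups on finite sets *)

Definition left_action (G : groupType) (T : Type) (a : G -> T -> T) : Prop :=
  a 1 =1 id /\ forall g h x, a (g * h) x = a g (a h x).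

Lemma left_actionK (G : groupType) (T : Type) (a : G -> T -> T) g :
  left_action a -> cancel (a g) (a g^-1).
Proof. by move=> [a1 aM] x; rewrite -aM mulVg a1. Qed.

Lemma left_actionVK (G : groupType) (T : Type) (a : G -> T -> T) g :
  left_action a -> cancel (a g^-1) (a g).
Proof. by move=> [a1 aM] x; rewrite -aM mulgV a1. Qed.

Section FreeGroupActions.
Variable d : nat.
Notation F := (free_group d).

Definition letter_val (b : letter d) : F :=
  if b.2 then (free_gen b.1)^-1 else free_gen b.1.

(** The group element spelled by a word that need not be reduced. *)
Definition word_val (w : seq (letter d)) : F :=
  foldr (fun b g => letter_val b * g) 1 w.

Lemma word_valK (g : F) : word_val (word g) = g.
Proof.
case: g; elim=> [|b w IH] wr; first by apply: val_inj.
have wr' : reduced w by exact: path_sorted wr.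
rewrite /= [word_val _](IH wr'); apply: val_inj.
case: b wr => i [] wr; rewrite /letter_val /=.
all: by case: w wr {IH wr'} => //= c w /andP[/negbTE-> _].
Qed.

Lemma word_val_rcons w b : word_val (rcons w b) = word_val w * letter_val b.
Proof. by elim: w => [|c w IH] /=; rewrite ?mulg1 ?mul1g // IH mulgA. Qed.

Lemma free_group_ind (P : F -> Prop) : P 1 ->
  (forall i g, P g -> P (free_gen i * g)) ->
  (forall i g, P g -> P ((free_gen i)^-1 * g)) -> forall g, P g.
Proof.
move=> P1 Pg PV g; rewrite -(word_valK g).
by elim: (word g) => //= -[i []] w; [exact: PV|exact: Pg].
Qed.

Lemma equivariant_gen (T U : Type) (a : F -> T -> T) (b : F -> U -> U)
    (f : T -> U) : left_action a -> left_action b ->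
  (forall i x, f (a (free_gen i) x) = b (free_gen i) (f x)) ->
  forall g x, f (a g x) = b g (f x).
Proof.
move=> aA bA fi; elim/free_group_ind.
- by move=> x; rewrite aA.1 bA.1.
- by move=> i g IH x; rewrite aA.2 bA.2 fi IH.
- move=> i g IH x; rewrite aA.2 bA.2 -IH.
  by rewrite -{2}(left_actionVK (free_gen i) aA (a g x)) fi left_actionK.
Qed.

(** The permutations are inverted because the product of two permutations applies
its left factor first. *)
Lemma finite_action_ex (V : finType) (s : 'I_d -> V -> V) :
  (forall i, bijective (s i)) ->
  exists2 a : F -> V -> V, left_action a & forall i, a (free_gen i) =1 s i.
Proof.
move=> sb; have sinj i : injective (s i) by exact: bij_inj.
have [phi [[[phi1 phiM] phig] _]] :=
  free_group_universal (fun i => (perm (@sinj i))^-1 : {perm V}).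
exists (fun g v => (phi g)^-1 v); first split.
- by move=> v; rewrite phi1 invg1 perm1.
- by move=> g h v; rewrite phiM invgM permM.
- by move=> i v; rewrite phig invgK permE.
Qed.

(** Colour a point by its whole pattern on the ball of radius n that contains the
window and apply the one-step model to this colouring. That the colours of the
model are then consistent along each word of length at most n follows by
induction on the word, removing the letter that acts first: the two ends of an
edge are labelled by the patterns of an actual point and of its image. *)
Theorem finite_pattern_model (R : realType) dT (T : measurableType dT)
    (mu : probability T R) (act : F -> T -> T) (A : finType) (c : T -> A)
    (W : seq F) :
  (0 < d)%N -> left_action act ->
  (forall g B, measurable B ->
     measurable (act g @^-1` B) /\ mu (act g @^-1` B) = mu B) ->
  (forall p, measurable (c @^-1` [set p])) ->
  exists (V : finType) (v0 : V) (a : F -> V -> V) (c' : V -> A),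
    left_action a /\
    forall v, exists t, forall g, g \in W -> c (act g t) = c' (a g v).
Proof.
move=> d0 actA mact mc.
pose n := \max_(g <- W) size (word g).
pose K := {ffun n.-bseq (letter d) -> A}.
(* The pattern of t on the ball of radius n, the elements being spelled by words. *)
pose k t : K := [ffun w : n.-bseq _ => c (act (word_val w) t)].
have mk p : measurable (k @^-1` [set p]).
  have -> : k @^-1` [set p] =
      \bigcap_(w in [set: n.-bseq (letter d)])
        (act (word_val w) @^-1` (c @^-1` [set p w])).
    apply/seteqP; split=> t.
      by move=> /= <- w _; rewrite /= ffunE.
    by move=> H; apply/ffunP => w; rewrite ffunE; exact: H.
  apply: fin_bigcap_measurable => [|w _]; first exact: finite_finset.
  by have [] := mact (word_val w) _ (mc (p w)).
have [V [v0 [s [kap [sb sP]]]]] :=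
  finite_flow_model mk (fun i B mB => mact (free_gen i) B mB).
have [a aA as_] := finite_action_ex sb.
pose bs w : n.-bseq (letter d) := insub_bseq n w.
have bsE w : (size w <= n)%N -> val (bs w) = w.
  by move=> wn; rewrite val_insubd wn.
(* For an inverse generator, follow the edge backwards: use the image of its source. *)
have step b v : exists t, k t = kap v /\
    k (act (letter_val b) t) = kap (a (letter_val b) v).
  case: b => i [] /=; rewrite /letter_val /=; last first.
    by rewrite as_; exact: sP.
  have [t [t1 t2]] := sP i (a (free_gen i)^-1 v).
  rewrite -as_ left_actionVK // in t2.
  by exists (act (free_gen i) t); rewrite left_actionK.
have main w : (size w <= n)%N -> forall v,
    kap (a (word_val w) v) (bs [::]) = kap v (bs w).
  elim/last_ind: w => [|w b IH] wn v; first by rewrite aA.1.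
  have wn' : (size w <= n)%N by rewrite size_rcons in wn; exact: ltnW.
  rewrite word_val_rcons aA.2 (IH wn').
  have [t [<- <-]] := step b v.
  by rewrite !ffunE !bsE // word_val_rcons actA.2.
exists V, v0, a, (fun v => kap v (bs [::])); split=> // v.
have [t [kt _]] := step (Ordinal d0, false) v.
exists t => g gW.
have gn : (size (word g) <= n)%N by exact: leq_bigmax_seq.
by rewrite -{2}(word_valK g) main // -kt ffunE bsE // word_valK.
Qed.

End FreeGroupActions.

(** * Finite factors and invariant measures *)

Definition factors_onto (G : groupType) (T : topologicalType)
    (alpha : G -> T -> T) (V : Type) (a : G -> V -> V) (phi : T -> V) : Prop :=
  [/\ left_action a, locally_constant phi
    & forall g x, phi (alpha g x) = a g (phi x)].

(** For Cantor space this says that every clopen set has a finite orbit; it is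
stated with factors because these persist under perturbation. *)
Definition profinite_action (G : groupType) (T : topologicalType)
    (alpha : G -> T -> T) : Prop :=
  forall (K : finType) (c : T -> K), locally_constant c ->
    exists (V : finType) (a : G -> V -> V) (phi : T -> V) (c' : V -> K),
      factors_onto alpha a phi /\ forall x, c x = c' (phi x).

Definition universal_action (G : groupType) (T : topologicalType)
    (alpha : G -> T -> T) : Prop :=
  forall (V : finType) (a : G -> V -> V), V -> left_action a ->
    exists phi : T -> V, factors_onto alpha a phi.

Lemma continuous_measurable (T U : ptopologicalType) (f : T -> U)
    (B : set (borel U)) : continuous f -> measurable B ->
  measurable (f @^-1` B : set (borel T)).
Proof.
move=> cf mB.
have := @measurability _ _ (borel T) (borel U) setT f (@open U) erefl.
move=> H; rewrite -[X in measurable X]setTI; apply: H => //.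
move=> _ [V oV <-]; rewrite setTI; apply: sub_sigma_algebra.
by have /continuousP := cf; exact.
Qed.

(** Clopen sets form a pi-system that generates the Borel sets. *)
Lemma probability_eq_clopen (R : realType)
    (mu nu : probability (borel cantor_space) R) :
  (forall C : set cantor_space, clopen C -> mu C = nu C) ->
  forall B, measurable B -> mu B = nu B.
Proof.
move=> e B mB.
apply: (@measure_unique _ R (borel cantor_space) (@clopen cantor_space)
  (fun _ => setT)) => //.
- exact: open_borel_clopen.
- by move=> C D cC cD; exact: clopenI.
- by move=> _; exact: clopenT.
- by apply/seteqP; split => // x _; exists 0%N.
- by move=> _; apply: (le_lt_trans (probability_le1 mu measurableT)); rewrite ltry.
Qed.

Section Invariant.
Variables (R : realType) (G : groupType) (alpha : G -> cantor_space -> cantor_space).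
Hypothesis cont : forall g, continuous (alpha g).
Hypothesis prof : profinite_action alpha.

(** Choose one point in each fiber of a factor map onto a finite action through
which the first n coordinates factor. The group permutes the points of the
image, and the cylinder of a point depends on its image alone, so the uniform
measure on the chosen points is invariant on cylinders of length n, although
the set of these points is not invariant. *)
Lemma level_mean n : exists p : set cantor_space -> R,
  finitely_additive_mean p /\
  forall g (C : set cantor_space), (forall x y, agree n x y -> C x -> C y) ->
    p (alpha g @^-1` C) = p C.
Proof.
have [V [a [phi [c [[aA lphi phiE] cE]]]]] := prof (@trunc_locally_constant n).
pose P : pred V := [pred v | `[< range phi v >] ].
have xv v : {x | P v -> phi x = v}.
  apply: cid; have [/asboolP[x _ <-]|nP] := boolP (P v); first by exists x.
  by exists point.
pose x v := projT1 (xv v).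
have xP v : P v -> phi (x v) = v by exact: projT2 (xv v).
have Pa g v : P (a g v) = P v.
  have h k w : P w -> P (a k w).
    by move=> /asboolP[y _ <-]; apply/asboolP; exists (alpha k y).
  apply/idP/idP; last exact: h.
  by move=> /(h g^-1%g); rewrite left_actionK.
exists (fun A => #|[pred v | P v && `[< A (x v) >]]|%:R / #|P|%:R)%R; split.
  apply: (@sample_mean R V P _ x (phi point)).
  by apply/asboolP; exists point.
move=> g C Cn; congr (_%:R / _)%R.
have sub y z : trunc n y = trunc n z -> C y = C z.
  move=> /truncP yz; apply/propext; split; apply: Cn => //; exact: agree_sym.
rewrite -[LHS]sum1_card -[RHS]sum1_card.
rewrite [RHS](reindex_inj (can_inj (left_actionK g aA))) /=.
apply: eq_bigl => v; rewrite !inE -[P (a g v)]/(P (a g v)) Pa.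
have [Pv /=|//] := boolP (P v); congr `[< _ >]; apply: sub.
by rewrite !cE phiE !xP // Pa.
Qed.

(** A clopen set is a union of cylinders of length n for all large n, so the
limiting mean is invariant on clopen sets. *)
Theorem profinite_pmp : pmp_action R alpha.
Proof.
have [p pP] := choice level_mean.
have [m mm mE] := ultralimit_mean (fun n => (pP n).1).
have [mu muE] := mean_extension mm.
exists mu => g B mB.
have mg : measurable_fun [set: borel cantor_space] (alpha g : borel cantor_space -> borel cantor_space).
  by move=> _ A mA; rewrite setTI; exact: continuous_measurable.
pose X : {mfun borel cantor_space >-> borel cantor_space} :=
  HB.pack (alpha g) (isMeasurableFun.Build _ _ _ _ _ mg).
apply/esym; apply: (@probability_eq_clopen R mu (distribution mu X)) => //.
move=> C cC.
have cgC : clopen (alpha g @^-1` C).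
  have [oC dC] := cC; split.
    by have /continuousP := @cont g; exact.
  by have /continuous_closedP := @cont g; exact.
rewrite muE // [RHS](muE _ cgC).
have [n nC] := clopen_level cC; congr (_%:E); apply: mE.
exists n => // k /= nk; apply/esym; have [_ ->//] := pP k.
by move=> x y /(agreeW nk)/nC.
Qed.

End Invariant.

(** * Profinite universal minimal actions and the profinite completion *)

(** The points whose orbit avoids U form a closed invariant set. *)
Lemma minimal_visits (G : groupType) (T : topologicalType)
    (alpha : G -> T -> T) (U : set T) (x : T) :
  (forall g, continuous (alpha g)) -> left_action alpha ->
  minimal_action alpha -> open U -> U !=set0 -> exists g, U (alpha g x).
Proof.
move=> ca aA mA oU [u Uu]; apply: contrapT => nU.
have := mA (\bigcap_g (alpha g @^-1` ~` U)).
have : (\bigcap_g (alpha g @^-1` ~` U)) x.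
  by move=> g _ Ug; apply: nU; exists g.
move=> H /(_ _ (ex_intro _ x H)) e.
have : (\bigcap_g (alpha g @^-1` ~` U)) u.
  rewrite e //.
  - apply: closed_bigI => g _; have /continuous_closedP := ca g; apply.
    exact: open_closedC.
  - by move=> g _ [y Hy <-] h _ /=; rewrite -aA.2; exact: Hy.
by move=> /(_ 1 I) /=; rewrite aA.1.
Qed.

Lemma visits_minimal (G : groupType) (T : topologicalType) (alpha : G -> T -> T) :
  (forall U x, open U -> U !=set0 -> exists g, U (alpha g x)) ->
  minimal_action alpha.
Proof.
move=> H Y cY [y Yy] iY; apply/seteqP; split=> // z _; apply: contrapT => nYz.
have [|g gy] := H (~` Y) y (closed_openC cY); first by exists z.
by apply: gy; apply: (iY g); exists y.
Qed.

Lemma finite_type_enum (T : choiceType) : finite_set [set: T] ->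
  exists (V : finType) (h : V -> T) (k : T -> V), cancel h k /\ cancel k h.
Proof.
move=> fT; pose s : seq T := finmap.enum_fset (fset_set [set: T]).
have ins t : t \in s by have := in_fset_set fT t; rewrite in_setT.
by exists (seq_sub s), (@ssval T s), (fun t => SeqSub (ins t)); split=> // -[t ts]; apply: val_inj.
Qed.

Section FiniteIndex.
Variable G : groupType.
Implicit Types N M : finite_index_normal G.

Lemma finite_index_normalP N : finite_index_normal G (val N).
Proof. exact: set_mem (valP N). Qed.

Lemma finite_index_mulV N g h : val N g -> val N h -> val N (g * h^-1).
Proof. by have [_ H _ _] := finite_index_normalP N; exact: H. Qed.

Lemma finite_index_inv N g : val N g -> val N g^-1.
Proof.
move=> Ng; rewrite -[g^-1]mul1g; apply: finite_index_mulV => //.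
by have [] := finite_index_normalP N.
Qed.

Lemma finite_index_mul N g h : val N g -> val N h -> val N (g * h).
Proof. by move=> Ng Nh; rewrite -[h]invgK; apply: finite_index_mulV => //; exact: finite_index_inv. Qed.

Lemma mem_lcoset N g h : lcoset g (val N) h <-> val N (g^-1 * h).
Proof.
split=> [[n Nn <-]|Nh]; first by rewrite mulKg.
by exists (g^-1 * h) => //; rewrite mulVKg.
Qed.

Lemma lcoset_eq N g h : lcoset g (val N) = lcoset h (val N) <-> val N (g^-1 * h).
Proof.
split=> [e|Nh].
  apply/mem_lcoset; rewrite e; apply/mem_lcoset; rewrite mulVg.
  by have [] := finite_index_normalP N.
apply/seteqP; split=> k /mem_lcoset Nk; apply/mem_lcoset.
  have -> : h^-1 * k = (g^-1 * h)^-1 * (g^-1 * k) by rewrite invgM invgK -mulgA mulVKg.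
  by apply: finite_index_mul => //; exact: finite_index_inv.
have -> : g^-1 * k = (g^-1 * h) * (h^-1 * k) by rewrite -mulgA mulVKg.
exact: finite_index_mul.
Qed.

Lemma finite_index_normalI N M :
  finite_index_normal G (val N `&` val M).
Proof.
have [N1 NV NJ Nf] := finite_index_normalP N.
have [M1 MV MJ Mf] := finite_index_normalP M.
split.
- by [].
- by move=> g h [Ng Mg] [Nh Mh]; split; [exact: NV|exact: MV].
- by move=> g h [Ng Mg]; split; [exact: NJ|exact: MJ].
- apply: sub_finite_set (finite_image (fun AB => AB.1 `&` AB.2) (finite_setX Nf Mf)).
  move=> _ [g _ <-]; exists (lcoset g (val N), lcoset g (val M)).
    by split; exists g.
  apply/seteqP; split=> [h /= [/mem_lcoset Nh /mem_lcoset Mh]|_ [h [Nh Mh] <-]].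
    by exists (g^-1 * h) => //; rewrite mulVKg.
  by split; exists h.
Qed.

(** A coset of the kernel is determined by the self-map of V that it induces. *)
Lemma action_kernel_finite_index (V : finType) (a : G -> V -> V) :
  left_action a -> finite_index_normal G [set g | forall v, a g v = v].
Proof.
move=> aA; split.
- exact: aA.1.
- move=> g h /= ag ah v; rewrite aA.2 -{1}(ah v) left_actionK //.
- move=> g h /= ag v; rewrite /conjg !aA.2 ag.
  by rewrite -{2}(left_actionK h aA v).
- pose S (f : {ffun V -> V}) := [set g | forall v, a g v = f v].
  apply: sub_finite_set (finite_image S (@finite_finset _ setT)).
  move=> _ [g _ <-]; exists [ffun v => a g v] => //.
  apply/seteqP; split=> [h /= H|_ [h /= H <-] v].
    exists (g^-1 * h); last by rewrite mulVKg.
    by move=> v; rewrite aA.2 H ffunE left_actionK.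
  by rewrite ffunE aA.2 H.
Qed.

End FiniteIndex.

Lemma translate_action (G : groupType) (N : set G) : left_action (@translate G N).
Proof.
have lc1 C : lcoset 1 C = C :> set G.
  apply/seteqP; split=> [_ [h Ch <-]|h Ch]; first by rewrite mul1g.
  by exists h => //; rewrite mul1g.
have lcM g h C : lcoset (g * h) C = lcoset g (lcoset h C) :> set G.
  apply/seteqP; split=> [_ [k Ck <-]|_ [_ [k Ck <-] <-]].
    by exists (h * k); [exists k|rewrite mulgA].
  by exists k => //; rewrite mulgA.
by split=> [C|g h C]; apply: val_inj; rewrite /= ?lc1 ?lcM.
Qed.

Lemma prod_locally_constant_continuous (X : topologicalType) (I : choiceType)
    (T : I -> topologicalType) (f : X -> prod_topology T) :
  (forall i, locally_constant (fun x => f x i)) -> continuous f.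
Proof.
move=> lf x U /prod_nbhs_base[W [V [xV VU]]].
have : \forall y \near x, forall i, i \in W -> f y i = f x i.
  elim: W {VU} => [|i W IH]; first by apply: filterE.
  apply: filterS (filterI (lf i x) IH) => y [/= e1 e2] j.
  by rewrite inE => /predU1P[->|/e2].
apply: filterS => y /= e; apply: VU => i iW; rewrite e //.
exact: nbhs_singleton (xV i).
Qed.

Section Isomorphism.
Variables (G : groupType) (alpha : G -> cantor_space -> cantor_space).
Hypotheses (calpha : forall g, continuous (alpha g)) (aA : left_action alpha).
Hypotheses (minA : minimal_action alpha) (profA : profinite_action alpha)
  (univA : universal_action alpha).
Implicit Types N M : finite_index_normal G.

Let x0 : cantor_space := point.

Lemma coset_factor N : exists phi : cantor_space -> quotient (val N),
  factors_onto alpha (@translate G (val N)) phi.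
Proof.
have [_ _ _ fN] := finite_index_normalP N.
have fT : finite_set [set: cosets (val N)].
  have -> : [set: cosets (val N)] = (fun C : cosets (val N) => val C) @^-1` cosets (val N).
    by apply/seteqP; split=> // -[C CN] _; exact: set_mem CN.
  by apply: finite_preimage fN => C D _ _ /val_inj.
have [V [h [k [hK kK]]]] := finite_type_enum fT.
pose a g v := k (translate g (h v)).
have aV : left_action a.
  have tA := translate_action (val N).
  by split=> [v|g g' v]; rewrite /a ?tA.1 ?hK // kK tA.2.
have q0 : cosets (val N) (lcoset 1 (val N)) by exists 1.
have v0 : V := k (SigSub (mem_set q0)).
have [phi [_ lphi phiE]] := univA v0 aV.
exists (h \o phi); split; [exact: translate_action|exact: locally_constantS|].
by move=> g x; rewrite /= phiE /a kK.
Qed.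

Let phi N : cantor_space -> quotient (val N) := projT1 (cid (coset_factor N)).

Let phiP N : factors_onto alpha (@translate G (val N)) (phi N).
Proof. exact: projT2 (cid (coset_factor N)). Qed.

(** The coset attached to x by the factor map onto G/N, described without
reference to the value of that map at the base point: it sends the base point to
N itself. The maps for different N are thereby compatible. *)
Definition orbit_coset N (x : cantor_space) : set G :=
  [set g | phi N (alpha g x0) = phi N x].

(** By minimality the base point can be moved into any clopen set around x, so
any two locally constant data at x are seen by one group element. *)
Lemma orbit_coset_visit (K : Type) (c : cantor_space -> K) N x :
  locally_constant c -> exists2 g, orbit_coset N x g & c (alpha g x0) = c x.
Proof.
move=> lc; have [_ lphi _] := phiP N.
have [||g [g1 g2]] := @minimal_visits G _ alpha
    ((phi N @^-1` [set phi N x]) `&` (c @^-1` [set c x])) x0 calpha aA minA.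
- by apply: openI; exact: locally_constant_open.
- by exists x.
- by exists g.
Qed.

(** Normality of N is what makes the stabilizers of all points of G/N equal to
N. *)
Lemma orbit_cosetE N x g : orbit_coset N x g -> orbit_coset N x = lcoset g (val N).
Proof.
have [[tr1 trM] lphi phiE] := phiP N; have [_ _ NJ _] := finite_index_normalP N.
rewrite /orbit_coset /= => gx.
have [b _ bE] := set_mem (valP (phi N x0 : cosets (val N))).
have key h k : phi N (alpha h x0) = phi N (alpha k x0) <-> val N (h^-1 * k).
  have valE j : val (phi N (alpha j x0) : cosets (val N)) = lcoset (j * b) (val N).
    rewrite phiE /= -bE; apply/seteqP; split=> [_ [_ [n Nn <-] <-]|_ [n Nn <-]].
      by exists n => //; rewrite mulgA.
    by exists (b * n); [exists n|rewrite mulgA].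
  transitivity (lcoset (h * b) (val N) = lcoset (k * b) (val N)).
    by rewrite -!valE; split=> [->//|/val_inj].
  rewrite lcoset_eq invgM -mulgA [_ * (k * b)]mulgA -conjgE; split; last exact: NJ.
  by move=> H; have := NJ _ b^-1 H; rewrite conjgK.
apply/seteqP; split=> h /=; rewrite -gx.
  by move=> /esym/key Nh; exists (g^-1 * h) => //; rewrite mulVKg.
by move=> /mem_lcoset Nh; apply/esym/key.
Qed.

Lemma orbit_coset_cosets N x : cosets (val N) (orbit_coset N x).
Proof.
have [g gx _] := orbit_coset_visit N x (fun _ => filterE _ (fun _ => erefl tt)).
by rewrite (orbit_cosetE gx); exists g.
Qed.

Definition orbit_point (x : cantor_space) :
    prod_topology (fun N : finite_index_normal G => quotient (val N)) :=
  fun N => SigSub (mem_set (orbit_coset_cosets N x)).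

Lemma orbit_point_completion x : profinite_completion G (orbit_point x).
Proof.
move=> N M NM /=.
have [_ lphi _] := phiP M; have [g gN gM] := orbit_coset_visit N x lphi.
rewrite (orbit_cosetE gN) (orbit_cosetE (gM : orbit_coset M x g)).
by move=> _ [n Nn <-]; exists n => //; exact: NM.
Qed.

Definition completion_map (x : cantor_space) : profinite_completion G :=
  SigSub (mem_set (@orbit_point_completion x)).

Lemma completion_map_continuous : continuous completion_map.
Proof.
apply: continuous_comp_initial.
apply: prod_locally_constant_continuous => N x.
have [_ lphi _] := phiP N; apply: filterS (lphi x) => y e.
by apply: val_inj; rewrite /= /orbit_coset e.
Qed.

Lemma completion_map_equivariant g x :
  completion_map (alpha g x) = universal_profinite_action g (completion_map x).
Proof.
apply: val_inj; apply: functional_extensionality_dep => N; apply: val_inj => /=.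
have [[tr1 trM] lphi phiE] := phiP N.
have [h hx _] := orbit_coset_visit N x lphi.
rewrite (orbit_cosetE hx); have ghx : orbit_coset N (alpha g x) (g * h).
  by rewrite /orbit_coset /= aA.2 !phiE in hx *; rewrite hx.
rewrite (orbit_cosetE ghx); apply/seteqP; split=> [_ [n Nn <-]|_ [_ [n Nn <-] <-]].
  by exists (h * n); [exists n|rewrite mulgA].
by exists n => //; rewrite mulgA.
Qed.

(** If x and y have different n-cylinders, these are separated by a factor map onto
a finite action, whose kernel N is a finite index subgroup for which the cosets
of x and y differ. *)
Lemma completion_map_injective : injective completion_map.
Proof.
move=> x y e; apply: agree_eq => n; apply/truncP.
have [V [a [psi [c [[aV lpsi psiE] cE]]]]] := profA (@trunc_locally_constant n).
pose N : finite_index_normal G := SigSub (mem_set (action_kernel_finite_index aV)).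
have [g gx gpsi] := orbit_coset_visit N x lpsi.
have [h hy hpsi] := orbit_coset_visit N y lpsi.
have : orbit_coset N y g.
  have : val (val (completion_map x) N : cosets (val N)) g by exact: gx.
  by rewrite e.
rewrite (orbit_cosetE hy) => /mem_lcoset /= hg.
rewrite !cE -gpsi -hpsi; congr c; rewrite !psiE.
by rewrite -[in RHS](hg (psi x0)) aV.2 left_actionVK.
Qed.

(** The sets of points with a prescribed coset of N are closed, nonempty, and
directed because finite index normal subgroups are stable under intersection. *)
Lemma completion_map_surjective z : exists x, completion_map x = z.
Proof.
pose F N := [set x | orbit_point x N = val z N].
have lF N : locally_constant (orbit_point ^~ N).
  have [_ lphi _] := phiP N => x; apply: filterS (lphi x) => y e.
  by apply: val_inj; rewrite /= /orbit_coset e.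
have F0 N : F N !=set0.
  have [g _ gE] := set_mem (valP (val z N : cosets (val N))).
  exists (alpha g x0); apply: val_inj => /=.
  by rewrite (@orbit_cosetE N (alpha g x0) g).
have FS N M : val N `<=` val M -> F N `<=` F M.
  move=> NM x Fx; apply: val_inj => /=.
  have [_ lphi _] := phiP M; have [g gN gM] := orbit_coset_visit N x lphi.
  rewrite (orbit_cosetE (gM : orbit_coset M x g)).
  have zNg : val (val z N : cosets (val N)) g by rewrite -Fx.
  have := set_mem (valP z) N M NM _ zNg.
  have [h _ hE] := set_mem (valP (val z M : cosets (val M))).
  rewrite -hE => /mem_lcoset hg; rewrite -[RHS]hE; apply/lcoset_eq.
  by rewrite -[_^-1 * h]invgK invgM invgK; exact: finite_index_inv.
have NT : finite_index_normal G setT.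
  split=> //; apply: sub_finite_set (finite_set1 setT) => _ [g _ <-].
  apply/seteqP; split=> // h _; exists (g^-1 * h) => //; exact: mulVKg.
have FF : ProperFilter (filter_from [set: finite_index_normal G] F).
  apply: filter_from_proper => //; apply: filter_from_filter.
    by exists (SigSub (mem_set NT)).
  move=> N M _ _; exists (SigSub (mem_set (finite_index_normalI N M))) => //.
  by move=> x Fx; split; apply: FS Fx => g [].
have [x [_ xF]] := cantor_space_compact FF (filterT).
exists x; apply: val_inj; apply: functional_extensionality_dep => N.
have cF : closed (F N) by exact: (@locally_constant_closed _ _ _ [set val z N] (lF N)).
apply: cF => B xB; apply: xF xB; first by exists N.
Qed.

Lemma completion_hausdorff : hausdorff_space (profinite_completion G).
Proof.
apply: separated_hausdorff => x y xy.
have [N xyN] : exists N, val x N <> val y N.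
  apply/existsNP => e; apply: xy; apply: val_inj.
  exact: functional_extensionality_dep.
exists (fun z : profinite_completion G => `[< val z N = val x N >]).
  apply: (@locally_constant_comp _ _ _ (fun z : profinite_completion G => val z)
    (fun z => `[< z N = val x N >])); first exact: initial_continuous.
  move=> z; pose Q N : topologicalType := quotient (val N).
  have H : nbhs (z : prod_topology Q) [set w : prod_topology Q | [set z N] (w N)].
    apply: (@prod_nbhs_coord _ Q).
    by apply: open_nbhs_nbhs; split => //; exact: discrete_open.
  by apply: (@filterS _ (nbhs (z : prod_topology Q)) _ _ _ _ H) => w /= ->.
by rewrite asboolT // asboolF // => /esym.
Qed.

Theorem isomorphic_completion :
  isomorphic_actions alpha (@universal_profinite_action G).
Proof.
exists completion_map; last exact: completion_map_equivariant.
apply: continuous_bijection_homeo.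
- exact: cantor_space_compact.
- exact: completion_hausdorff.
- exact: completion_map_continuous.
exists (fun z => projT1 (cid (completion_map_surjective z))) => x.
  apply: completion_map_injective.
  exact: projT2 (cid (completion_map_surjective (completion_map x))).
exact: projT2 (cid (completion_map_surjective x)).
Qed.

End Isomorphism.

(** * Existence of a profinite universal minimal action *)

(** Uniform continuity of the inverse of an embedding. *)
Lemma embedding_uniform (f : cantor_space -> cantor_space) m :
  continuous f -> injective f ->
  exists k, forall x y, agree k (f x) (f y) -> agree m x y.
Proof.
move=> cf fi.
have [||k kP] := @compact_uniform cantor_space setT
  (fun n x => forall y, agree n (f x) (f y) -> agree m x y) cantor_space_compact.
- by move=> n n' x nn' H y /(agreeW nn')/H.
(* The image of the closed set C does not contain f x. *)
- move=> x _; pose C := [set y | ~ agree m x y].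
  have cC : closed C.
    have -> : C = trunc m @^-1` [set t | t <> trunc m x].
      apply/seteqP; split=> y /= H e; apply: H; first exact/truncP/esym.
      by apply/esym/truncP.
    apply: locally_constant_closed; exact: trunc_locally_constant.
  have cfC := continuous_image_closed cantor_space_compact cantor_space_hausdorff cf cC.
  have nfC : (~` (f @` C)) (f x) by move=> [y Cy /fi e]; apply: Cy; rewrite e.
  have [n nP] := nbhs_agree (open_nbhs_nbhs (conj (closed_openC cfC) nfC)).
  exists n.
  have fx : \forall y \near x, agree n (f x) (f y) := cf x _ (agree_nbhs n (f x)).
  apply: filterS (filterI fx (agree_nbhs m x)) => x' [/= e1 e2] y e3.
  apply: agree_trans (agree_sym e2) _; apply: contrapT => H.
  by apply: (nP _ (agree_trans e1 e3)); exists y.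
- by exists k => x y; exact: kP.
Qed.

(** Two powers of s act in the same way by the pigeonhole principle. *)
Lemma action_power_trivial (G : groupType) (V : finType) (a : G -> V -> V) (s : G) :
  left_action a -> exists2 k, (0 < k)%N & forall v, a (s ^+ k) v = v.
Proof.
move=> aA; pose N := #|{ffun V -> V}|.
pose p (k : 'I_N.+1) := [ffun v => a (s ^+ k) v] : {ffun V -> V}.
have : ~~ injectiveb p.
  by apply/negP => /injectiveP/leq_card; rewrite card_ord ltnn.
case/injectivePn => x [y xy pxy].
wlog {xy} xy : x y pxy / (x < y)%N.
  move=> H; case: (ltngtP x y) => [h|h|/val_inj e].
  - exact: (H x y).
  - exact: (H y x).
  - by rewrite e eqxx in xy.
exists (y - x)%N => [|v]; first by rewrite subn_gt0.
have := congr1 (fun f : {ffun V -> V} => f v) pxy; rewrite !ffunE.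
rewrite -{1}(subnKC (ltnW xy)) expgnDr aA.2 => /(can_inj (left_actionK _ aA)).
by [].
Qed.

Lemma action_Xi (G : groupType) (alpha : G -> cantor_space -> cantor_space) :
  (forall g, continuous (alpha g)) -> left_action alpha ->
  exists xi : Xi G, cantor_action xi = alpha.
Proof.
move=> ca aA.
have ha g : homeomorphism (alpha g).
  split; first exact: ca.
  by exists (alpha g^-1); split; [exact: ca|exact: left_actionK|exact: left_actionVK].
have mm : Xi G (fun g => mk_homeo (ha g)).
  split=> [|g h] /=; apply: homeo_inj => x; first exact: aA.1.
  exact: aA.2.
by exists (SigSub (mem_set mm)).
Qed.

Section Construction.
Variables (R : realType) (d : nat).
Hypothesis d0 : (0 < d)%N.
Notation F := (free_group d).

(** All actions of the free group on the sets 0, ..., m, given by the permutations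
attached to the generators: a countable collection. *)
Definition model : Type := {m : nat & {ffun 'I_d -> {perm 'I_m.+1}}}.
HB.instance Definition _ := Countable.on model.

Definition marked_model : Type := {j : model & 'I_(tag j).+1}.
HB.instance Definition _ := Countable.on marked_model.

Lemma model_action_ex (j : model) : exists a : F -> 'I_(tag j).+1 -> 'I_(tag j).+1,
  left_action a /\ forall i, a (free_gen i) =1 (tagged j i : {perm _}).
Proof.
have [|a aA aE] := @finite_action_ex d 'I_(tag j).+1 (fun i => (tagged j i : {perm _})).
  by move=> i; exists (tagged j i)^-1 => x; rewrite ?permK ?permKV.
by exists a.
Qed.

Definition model_action (j : model) := projT1 (cid (model_action_ex j)).

Arguments model_action : clear implicits.

Lemma model_actionP j : left_action (model_action j).
Proof. exact: (projT2 (cid (model_action_ex j))).1. Qed.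

Lemma model_action_gen j i : model_action j (free_gen i) =1 (tagged j i : {perm _}).
Proof. exact: (projT2 (cid (model_action_ex j))).2. Qed.

(** The action is transported along an enumeration of V. *)
Lemma model_complete (V : finType) (a : F -> V -> V) : V -> left_action a ->
  exists (j : model) (from : 'I_(tag j).+1 -> V) (to : V -> 'I_(tag j).+1),
    [/\ cancel from to, cancel to from
      & forall g u, from (model_action j g u) = a g (from u)].
Proof.
move=> v0 aV.
have cV : (0 < #|V|)%N by apply/card_gt0P; exists v0.
have eV : #|V| = #|V|.-1.+1 by rewrite prednK.
pose m := #|V|.-1.
pose to (v : V) : 'I_m.+1 := cast_ord eV (enum_rank v).
pose from (i : 'I_m.+1) : V := enum_val (cast_ord (esym eV) i).
have toK : cancel to from by move=> v; rewrite /from /to cast_ordK enum_rankK.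
have fromK : cancel from to by move=> v; rewrite /from /to enum_valK cast_ordKV.
pose b g i := to (a g (from i)).
have bA : left_action b.
  by split=> [i|g h i]; rewrite /b ?aV.1 ?fromK // toK aV.2.
have binj i : injective (b (free_gen i)) by exact: can_inj (left_actionK _ bA).
pose j : model := Tagged (fun m => {ffun 'I_d -> {perm 'I_m.+1}})
  [ffun i => perm (@binj i)].
exists j, from, to; split=> // g u; rewrite -[RHS]toK; congr from.
apply: (@equivariant_gen d _ _ (model_action j) b id) => //.
  exact: model_actionP.
by move=> i x; rewrite model_action_gen /= ffunE permE.
Qed.

(** The finite actions are placed side by side on the natural numbers, so that tau
acts with finite orbits; the naturals that encode nothing are fixed. *)
Definition coord (j : model) (v : 'I_(tag j).+1) : nat :=
  pickle (Tagged (fun j : model => 'I_(tag j).+1) v : marked_model).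

Definition coord_inv (n : nat) : option marked_model := pickle_inv n.

Lemma coordK j v : coord_inv (@coord j v) = Some (Tagged (fun j : model => 'I_(tag j).+1) v).
Proof. exact: pickleK_inv. Qed.

Lemma coord_invK n (x : marked_model) : coord_inv n = Some x -> coord (tagged x) = n.
Proof.
move=> e; have := @pickle_invK marked_model n; rewrite /coord_inv in e; rewrite e /= => <-.
by case: x {e}.
Qed.

Definition tau (g : F) (n : nat) : nat :=
  if coord_inv n is Some x then coord (model_action (tag x) g (tagged x)) else n.

Lemma tau_coord g j v : tau g (@coord j v) = coord (model_action j g v).
Proof. by rewrite /tau coordK. Qed.

Lemma tau_action : left_action tau.
Proof.
split=> [n|g h n]; rewrite /tau.
  by case e: (coord_inv n) => [x|//]; rewrite (model_actionP _).1 (coord_invK e).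
case e: (coord_inv n) => [x|]; last by rewrite e.
by rewrite coordK (model_actionP _).2.
Qed.

Lemma tau_finite_orbits k : exists D : seq nat,
  (forall n, (n < k)%N -> n \in D) /\ forall g n, n \in D -> tau g n \in D.
Proof.
pose D n := if coord_inv n is Some x then
  [seq @coord (tag x) v | v <- enum 'I_(tag (tag x)).+1] else [:: n].
have Dn n : n \in D n.
  rewrite /D; case e: (coord_inv n) => [x|]; last by rewrite inE.
  by rewrite -{1}(coord_invK e); apply: map_f; rewrite mem_enum.
exists (flatten [seq D n | n <- iota 0 k]); split=> [n nk|g n].
  by apply/flatten_mapP; exists n => //; rewrite mem_iota.
move=> /flatten_mapP[m mk nD]; apply/flatten_mapP; exists m => //.
move: nD; rewrite /D; case e: (coord_inv m) => [x|].
  by move=> /mapP[v _ ->]; rewrite tau_coord; apply: map_f; rewrite mem_enum.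
by rewrite inE => /eqP->; rewrite /tau e inE.
Qed.

Definition theta (g : F) (x : cantor_space) : cantor_space :=
  fun n => x (tau g^-1 n).

Lemma theta_action : left_action theta.
Proof.
split=> [x|g h x]; apply/funext => n; rewrite /theta.
  by rewrite invg1 tau_action.1.
by rewrite invgM tau_action.2.
Qed.

Definition agree_on (D : seq nat) (x y : cantor_space) := forall n, n \in D -> x n = y n.

Lemma agree_agree_on D : exists k, forall x y, agree k x y -> agree_on D x y.
Proof.
exists (\max_(n <- D) n).+1 => x y xy n nD; apply: xy.
by rewrite ltnS; exact: leq_bigmax_seq.
Qed.

Lemma agree_on_theta D g x y : (forall g n, n \in D -> tau g n \in D) ->
  agree_on D x y -> agree_on D (theta g x) (theta g y).
Proof. by move=> DD xy n nD; apply: xy; exact: DD. Qed.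

Lemma theta_continuous g : continuous (theta g).
Proof.
apply: agree_continuous => n.
have [k kP] := agree_agree_on [seq tau g^-1 i | i <- iota 0 n].
exists k => x y /kP xy i ni; apply: xy; apply: map_f.
by rewrite mem_iota.
Qed.

(** In each finite action the coordinates of this point mark the element 0. *)
Definition base : cantor_space :=
  fun n => if coord_inv n is Some x then tagged x == ord0 else false.

Definition orbit_closure : set cantor_space :=
  [set y | forall k, exists g, agree k (theta g base) y].

Lemma orbit_closure_closed : closed orbit_closure.
Proof.
apply: cantor_closed_agree => x H k; have [y /(_ k)[g gy] xy] := H k.
by exists g; apply: agree_trans gy _; exact: agree_sym.
Qed.

(** Since the orbits of tau are finite, prescribing finitely many coordinates can
always be done on a finite invariant set of coordinates. *)
Lemma orbit_closure_on D y : orbit_closure y -> exists g, agree_on D (theta g base) y.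
Proof.
move=> yZ; have [k kP] := agree_agree_on D; have [g gy] := yZ k.
by exists g; exact: kP.
Qed.

Lemma orbit_closure_theta g y : orbit_closure y -> orbit_closure (theta g y).
Proof.
move=> yZ k; have [D [kD DD]] := tau_finite_orbits k.
have [h hy] := orbit_closure_on D yZ; exists (g * h) => n /kD nD.
by rewrite theta_action.2; exact: agree_on_theta nD.
Qed.

(** On a finite invariant set of coordinates both y and z coincide with translates
of the base point. *)
Lemma orbit_closure_minimal y z k : orbit_closure y -> orbit_closure z ->
  exists g, agree k (theta g y) z.
Proof.
move=> yZ zZ; have [D [kD DD]] := tau_finite_orbits k.
have [g gy] := orbit_closure_on D yZ; have [h hz] := orbit_closure_on D zZ.
exists (h * g^-1) => n /kD nD; rewrite -hz // theta_action.2.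
have := agree_on_theta (h * g^-1) DD gy nD.
by rewrite -!theta_action.2 mulgVK => ->; rewrite theta_action.2.
Qed.

Lemma theta_base j g v : theta g base (@coord j v) = (v == model_action j g ord0).
Proof.
rewrite /theta tau_coord /base coordK /=.
by apply/eqP/eqP => [<-|->]; rewrite ?left_actionVK ?left_actionK //; exact: model_actionP.
Qed.

Lemma orbit_closure_mark j y : orbit_closure y ->
  exists u : 'I_(tag j).+1, forall v, y (coord v) = (v == u).
Proof.
move=> yZ.
have [g gy] := orbit_closure_on [seq @coord j v | v <- enum 'I_(tag j).+1] yZ.
exists (model_action j g ord0) => v; rewrite -gy ?theta_base //.
by apply: map_f; rewrite mem_enum.
Qed.

(** Long rotations are the finite actions that show that the orbit closure has no
isolated point. *)
Definition rotation_model (m : nat) : model :=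
  Tagged (fun m => {ffun 'I_d -> {perm 'I_m.+1}})
    [ffun i => perm (bij_inj (@ordS_bij m.+1))].

Lemma rotation_power m i k v :
  val (model_action (rotation_model m) (free_gen i ^+ k) v) = ((v + k) %% m.+1)%N.
Proof.
have aA := model_actionP (rotation_model m).
elim: k => [|k IH]; first by rewrite aA.1 addn0 modn_small.
rewrite expgS aA.2 model_action_gen /= ffunE permE /= IH.
by rewrite -addn1 modnDml addn1 addnS.
Qed.

(** Some power s ^ k of a generator acts trivially on the coordinates to be
kept; it moves x, because it has no fixed point on the rotation of k + 1 points.
This is where a generator is needed: without one the closure would be a point. *)
Lemma orbit_closure_perfect x n : orbit_closure x ->
  exists y, [/\ orbit_closure y, y <> x & agree n x y].
Proof.
move=> xZ; have [D [nD DD]] := tau_finite_orbits n.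
pose s : F := free_gen (Ordinal d0).
pose a g (v : seq_sub D) : seq_sub D := SeqSub (DD g _ (valP v)).
have aA : left_action a.
  by split=> [v|g h v]; apply: val_inj; rewrite /= ?tau_action.1 ?tau_action.2.
have [k k0 kP] := action_power_trivial s aA.
exists (theta (s ^+ k) x); split; first exact: orbit_closure_theta.
  move=> e; have [u uP] := orbit_closure_mark (rotation_model k) xZ.
  have := congr1 (fun y : cantor_space => y (coord (model_action _ (s ^+ k) u))) e.
  rewrite /theta tau_coord left_actionK; last exact: model_actionP.
  rewrite !uP eqxx => /esym/eqP/(congr1 val); rewrite rotation_power.
  have uk := ltn_ord u; rewrite /= in uk.
  have [small|big] := ltnP (u + k) k.+1.
    by rewrite modn_small // => /eqP; rewrite -[X in _ == X]addn0 eqn_add2l; case: (k) k0.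
  rewrite -{1}(subnK big) modnDr modn_small; last first.
    rewrite ltn_subLR //; apply: leq_trans (_ : u + k < k.+1 + k)%N _.
      by rewrite ltn_add2r.
    by rewrite leq_add2l.
  move=> e2; have : (u + k = u + k.+1)%N by rewrite -{2}e2 subnK.
  by move/eqP; rewrite eqn_add2l ltn_eqF.
move=> i /nD iD; rewrite /theta.
have := kP (a (s ^+ k)^-1 (SeqSub iD)); rewrite (left_actionVK _ aA).
by move=> /(congr1 val) /= <-.
Qed.

Lemma base_orbit_closure : orbit_closure base.
Proof. by move=> k; exists 1 => i _; rewrite theta_action.1. Qed.

(** The orbit closure of the base point, transported to Cantor space by an
embedding f whose image it is. Colourings depend on finitely many coordinates,
hence on a finite invariant set of them, and the mark in a finite action is an
equivariant map onto it. *)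
Theorem profinite_universal_minimal_ex : exists xi : Xi F,
  [/\ minimal_action (cantor_action xi), profinite_action (cantor_action xi)
    & universal_action (cantor_action xi)].
Proof.
have [|f [cf fi fZ]] := cantor_embedding R orbit_closure_closed _ (fun x n => @orbit_closure_perfect x n).
  by exists base; exact: base_orbit_closure.
have Zf x : orbit_closure (f x) by rewrite -fZ; exists x.
have finv g x : {y | f y = theta g (f x)}.
  apply: cid; have : orbit_closure (theta g (f x)) by exact: orbit_closure_theta.
  by rewrite -fZ => -[y _ <-]; exists y.
pose alpha g x := projT1 (finv g x).
have alphaE g x : f (alpha g x) = theta g (f x) by exact: projT2 (finv g x).
have calpha g : continuous (alpha g).
  apply: agree_continuous => n; have [k kP] := embedding_uniform n cf fi.
  have [k1 k1P] := continuous_agree k (@theta_continuous g).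
  have [k2 k2P] := continuous_agree k1 cf.
  by exists k2 => x y /k2P/k1P; rewrite -!alphaE => /kP.
have aA : left_action alpha.
  split=> [x|g h x]; apply: fi; rewrite !alphaE; first by rewrite theta_action.1.
  by rewrite theta_action.2.
have [xi xiE] := action_Xi calpha aA.
exists xi; rewrite xiE; split.
- apply: visits_minimal => U x oU [u Uu].
  have [m mU] := nbhs_agree (open_nbhs_nbhs (conj oU Uu)).
  have [k kP] := embedding_uniform m cf fi.
  have [g gP] := orbit_closure_minimal k (Zf x) (Zf u).
  by exists g; apply: mU; apply: kP; rewrite alphaE; exact: agree_sym.
- move=> K c lc; have [m mP] := locally_constant_uniform lc.
  have [k kP] := embedding_uniform m cf fi.
  have [D [kD DD]] := tau_finite_orbits k.
  pose b g (v : seq_sub D) : seq_sub D := SeqSub (DD g _ (valP v)).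
  pose V : finType := {ffun seq_sub D -> bool}.
  pose a g (w : V) : V := [ffun v => w (b g^-1 v)].
  pose psi x : V := [ffun v => f x (val v)].
  have psic x y : psi x = psi y -> c x = c y.
    move=> /ffunP e; apply/mP/kP => n /kD nD.
    by have := e (SeqSub nD); rewrite !ffunE.
  have cV w : exists e : K, forall x, psi x = w -> c x = e.
    have [[x xw]|H] := pselect (exists x, psi x = w).
      by exists (c x) => y yw; apply: psic; rewrite yw.
    by exists (c point) => x xw; case: H; exists x.
  exists V, a, psi, (fun w => projT1 (cid (cV w))); split; first split.
  + split=> [w|g h w]; apply/ffunP => v; rewrite !ffunE; congr (w _); apply: val_inj.
      by rewrite /= invg1 tau_action.1.
    by rewrite /= invgM tau_action.2.
  + move=> x; have [n nP] := agree_agree_on D.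
    have fx : \forall y \near x, agree n (f x) (f y) := cf x _ (agree_nbhs n (f x)).
    apply: filterS fx => y /nP e.
    by apply/ffunP => v; rewrite !ffunE e //; exact: valP v.
  + by move=> g x; apply/ffunP => v; rewrite !ffunE alphaE.
  + by move=> x; exact: (projT2 (cid (cV (psi x)))).
- move=> V a v0 aV.
  have [j [from [to [fromK toK jE]]]] := model_complete v0 aV.
  pose mark x : {u : 'I_(tag j).+1 | forall v, f x (@coord j v) = (v == u)} :=
    cid (orbit_closure_mark j (Zf x)).
  exists (fun x => from (projT1 (mark x))); split=> //.
  + have [n nP] := agree_agree_on [seq @coord j v | v <- enum 'I_(tag j).+1].
    move=> x.
    have fx : \forall y \near x, agree n (f x) (f y) := cf x _ (agree_nbhs n (f x)).
    apply: filterS fx => y /nP e.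
    congr from; apply/eqP.
    rewrite -(projT2 (mark x)) e; last by apply: map_f; rewrite mem_enum.
    by rewrite (projT2 (mark y)) eqxx.
  + move=> g x; rewrite -jE; congr from; apply/eqP.
    rewrite eq_sym -(projT2 (mark (alpha g x))) alphaE /theta.
    rewrite tau_coord left_actionK; last exact: model_actionP.
    by rewrite (projT2 (mark x)) eqxx.
Qed.

End Construction.

Arguments model_action {d} j _ _.

(** * Genericity of the conjugacy class *)

Lemma cantor_action_left (G : groupType) (xi : Xi G) :
  left_action (cantor_action xi).
Proof.
have [xi1 xiM] := set_mem (valP xi).
by split=> [x|g h x]; rewrite /cantor_action ?[val xi 1]xi1 ?[val xi (g * h)]xiM.
Qed.

Lemma cantor_action_continuous (G : groupType) (xi : Xi G) g :
  continuous (cantor_action xi g).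
Proof. by have [] := homeoP (val xi g : Homeo). Qed.

Lemma conj_actionE (G : groupType) (h : Homeo) (xi : Xi G) g x :
  cantor_action (conj_action h xi) g (h x) = h (cantor_action xi g x).
Proof.
have -> : cantor_action (conj_action h xi) g (h x) =
  h (cantor_action xi g (homeo_inv h (h x))) by [].
by rewrite homeoK.
Qed.

Lemma conjugate_of_equivariant (G : groupType) (xi eta : Xi G)
    (h : cantor_space -> cantor_space) : homeomorphism h ->
  (forall g x, h (cantor_action xi g x) = cantor_action eta g (h x)) ->
  conjugacy_class xi eta.
Proof.
move=> hh hE; exists (mk_homeo hh) => //; apply: val_inj.
apply/funext => g; apply: homeo_inj => x.
rewrite -[x](homeoVK (mk_homeo hh)).
transitivity (mk_homeo hh (cantor_action xi g (homeo_inv (mk_homeo hh) x))).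
  exact: (@conj_actionE _ (mk_homeo hh) xi g _).
exact: hE.
Qed.

Section Transport.
Variables (G : groupType) (xi : Xi G) (h : Homeo).

Lemma conj_minimal : minimal_action (cantor_action xi) ->
  minimal_action (cantor_action (conj_action h xi)).
Proof.
move=> mxi; apply: visits_minimal => U x oU [u Uu].
have [ch _] := homeoP h.
have oV : open (h @^-1` U) by have /continuousP := ch; exact.
have [|g gU] := @minimal_visits G _ (cantor_action xi) (h @^-1` U) (homeo_inv h x)
    (@cantor_action_continuous _ xi) (cantor_action_left xi) mxi oV.
  by exists (homeo_inv h u); rewrite /= homeoVK.
by exists g; rewrite -(homeoVK h x) conj_actionE.
Qed.

Lemma conj_factors (V : Type) (a : G -> V -> V) phi :
  factors_onto (cantor_action xi) a phi ->
  factors_onto (cantor_action (conj_action h xi)) a (phi \o homeo_inv h).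
Proof.
move=> [aA lphi phiE]; split=> //.
  by apply: locally_constant_comp => //; have [] := homeoP (homeo_inv h).
by move=> g x; rewrite /= -{1}(homeoVK h x) conj_actionE homeoK phiE.
Qed.

Lemma conj_profinite : profinite_action (cantor_action xi) ->
  profinite_action (cantor_action (conj_action h xi)).
Proof.
move=> pxi K c lc.
have [|V [a [phi [c' [ph cE]]]]] := pxi K (c \o h).
  by apply: locally_constant_comp => //; have [] := homeoP h.
exists V, a, (phi \o homeo_inv h), c'; split; first exact: conj_factors.
by move=> x; rewrite /= -cE /= homeoVK.
Qed.

Lemma conj_universal : universal_action (cantor_action xi) ->
  universal_action (cantor_action (conj_action h xi)).
Proof.
move=> uxi V a v0 aV; have [phi ph] := uxi V a v0 aV.
by exists (phi \o homeo_inv h); exact: conj_factors.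
Qed.

End Transport.

(** The composite of one isomorphism and the inverse of the other is the
conjugating homeomorphism. *)
Lemma conjugate_of_isomorphic (G : groupType) (U : topologicalType)
    (beta : G -> U -> U) (xi eta : Xi G) :
  isomorphic_actions (cantor_action xi) beta ->
  isomorphic_actions (cantor_action eta) beta -> conjugacy_class xi eta.
Proof.
move=> [f hf fE] [f' [cf' [g [cg f'K gK]]] f'E].
have hg : homeomorphism g by split=> //; exists f'.
apply: (@conjugate_of_equivariant _ _ _ (g \o f)); first exact: homeomorphism_comp.
by move=> k x; rewrite /= fE -{1}(gK (f x)) -f'E f'K.
Qed.

Section Neighbourhoods.
Variable d : nat.
Notation F := (free_group d).

(** A locally constant map ignores small perturbations, so the same map phi works,
and equivariance only has to be tested on the finitely many generators. *)
Lemma factors_onto_near (eta : Xi F) (V : Type) (a : F -> V -> V) phi :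
  factors_onto (cantor_action eta) a phi ->
  nbhs eta [set eta' : Xi F | factors_onto (cantor_action eta') a phi].
Proof.
move=> [aA lphi phiE]; have [n nP] := locally_constant_uniform lphi.
pose XF := prod_topology (fun _ : F => Homeo).
pose Q (i : 'I_d) (x : XF) := forall x0,
  agree n ((val eta (free_gen i) : Homeo) x0) ((x (free_gen i) : Homeo) x0).
have nQ : nbhs (val eta : XF) [set x | forall i, Q i x].
  apply: (@filter_forall XF 'I_d Q (nbhs (val eta : XF)) _) => i.
  have hA := homeo_agree_nbhs (val eta (free_gen i) : Homeo) n.
  exact: (@prod_nbhs_coord _ (fun _ : F => Homeo) (val eta) (free_gen i) _ hA).
have nQ' : nbhs eta [set eta' : Xi F | forall i, Q i (val eta')].
  exact: (@initial_continuous _ _ (fun x : Xi F => val x) eta _ nQ).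
apply: filterS nQ' => eta' Qeta'; split=> //.
apply: equivariant_gen => //; first exact: cantor_action_left.
by move=> i x; rewrite -phiE; apply/esym/nP; exact: Qeta'.
Qed.

Lemma Xi_nbhs_base (eta : Xi F) (U : set (Xi F)) : nbhs eta U ->
  exists (W : seq F) (n : nat), forall eta' : Xi F,
    (forall g, g \in W -> forall x,
       agree n (cantor_action eta g x) (cantor_action eta' g x)) -> U eta'.
Proof.
move=> [_ [[A oA <-] Aeta sA]].
have [W [B [Beta BA]]] := prod_nbhs_base (open_nbhs_nbhs (conj oA Aeta)).
have H g : exists n, forall f' : Homeo,
    (forall x, agree n (cantor_action eta g x) (f' x)) -> B g f'.
  exact: homeo_nbhs_agree (Beta g).
have [N NP] := choice H.
exists W, (\max_(g <- W) N g) => eta' eP; apply: sA; apply: BA => g gW.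
apply: NP => x; apply: agreeW (eP g gW x).
exact: leq_bigmax_seq.
Qed.

(** By compactness, and because the group is countable, finitely many elements
suffice for all points at once. *)
Lemma finite_visits (alpha : F -> cantor_space -> cantor_space) (U : set cantor_space) :
  (forall g, continuous (alpha g)) -> left_action alpha ->
  minimal_action alpha -> open U -> U !=set0 ->
  exists W : seq F, forall x, exists2 g, g \in W & U (alpha g x).
Proof.
move=> ca aA mA oU U0.
have [||n nP] := @compact_uniform cantor_space setT
  (fun n x => exists2 g : F, (pickle g < n)%N & U (alpha g x)) cantor_space_compact.
- by move=> n m x nm [g gn gU]; exists g => //; exact: leq_trans nm.
- move=> x _; have [g gU] := minimal_visits x ca aA mA oU U0.
  exists (pickle g).+1.
  have : nbhs x (alpha g @^-1` U).
    by apply: ca; exact: open_nbhs_nbhs.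
  by apply: filterS => y Uy; exists g.
- exists (pmap unpickle (iota 0 n)) => x; have [//|g gn gU] := nP x.
  by exists g => //; rewrite mem_pmap -(pickleK g) map_f // mem_iota.
Qed.

Lemma continuous_agree_seq (alpha : F -> cantor_space -> cantor_space) (W : seq F) n :
  (forall g, continuous (alpha g)) ->
  exists2 m, (n <= m)%N & forall g, g \in W -> forall x y,
    agree m x y -> agree n (alpha g x) (alpha g y).
Proof.
move=> ca; elim: W => [|g W [m nm mP]]; first by exists n.
have [k kP] := continuous_agree n (ca g).
exists (maxn m k) => [|h]; first by rewrite leq_max nm.
rewrite inE => /predU1P[->|hW] x y xy.
  by apply: kP; apply: agreeW xy; exact: leq_maxr.
by apply: mP => //; apply: agreeW xy; exact: leq_maxl.
Qed.

(** The colours are the m-cylinders, with m large enough for an m-cylinder to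
determine the n-cylinders of the images under W. The window contains W, so that
the finite model sees how W moves cylinders, and elements that take each point
to each m-cylinder, so that all colours occur in every part of the model. *)
Theorem conjugates_approximate (R : realType) (xi eta : Xi F) (W : seq F) n :
  (0 < d)%N -> universal_action (cantor_action xi) ->
  minimal_action (cantor_action eta) -> pmp_action R (cantor_action eta) ->
  exists h : Homeo, forall g, g \in W -> forall x,
    agree n (cantor_action eta g x) (cantor_action (conj_action h xi) g x).
Proof.
move=> d0 uxi meta [mu muE].
have ce := @cantor_action_continuous _ eta; have aE := cantor_action_left eta.
have [m nm mP] := continuous_agree_seq W n ce.
have lt := @trunc_locally_constant m.
have visit (p : {ffun 'I_m -> bool}) : exists W' : seq F, range (trunc m) p ->
    forall x, exists2 g, g \in W' & trunc m (cantor_action eta g x) = p.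
  have [rp|nrp] := pselect (range (trunc m) p); last by exists [::].
  have [|W' W'P] := finite_visits ce aE meta (locally_constant_open [set p] lt).
    by have [x _ xp] := rp; exists x.
  by exists W'.
have [T TP] := choice visit.
(* The identity lets the model see the colour of the point itself. *)
pose W1 := 1 :: W ++ flatten [seq T p | p <- enum {ffun 'I_m -> bool}].
have [||V [v0 [a [c [aV cP]]]]] := @finite_pattern_model d R _ (borel cantor_space) mu
    (cantor_action eta) _ (trunc m) W1 d0 aE.
- by move=> g B mB; split; [exact: continuous_measurable|exact: muE].
- by move=> p; apply: sub_sigma_algebra; exact: locally_constant_open.
have [phi [_ lphi phiE]] := uxi V a v0 aV.
have [|h hP] := cantor_fiber_homeo R lt (locally_constantS c lphi).
  apply/seteqP; split=> p.
    move=> rp; have [t tP] := cP (phi point).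
    have [g gT gp] := TP p rp t.
    have gW : g \in W1.
      rewrite inE mem_cat; apply/orP; right; apply/orP; right.
      by apply/flatten_mapP; exists p => //; rewrite mem_enum.
    by exists (cantor_action xi g point) => //=; rewrite phiE -tP.
  move=> [x _ <-] /=; have [t tP] := cP (phi x).
  have := tP 1 (mem_head _ _); rewrite aE.1 aV.1 => <-.
  by exists t.
exists h => g gW x; rewrite -{2}(homeoVK h x) conj_actionE.
(* Some t has the m-cylinder of x, while its image under eta g has that of the image
   of x under the conjugate. *)
set y := homeo_inv h x.
have [t tP] := cP (phi y).
have gW1 : g \in W1 by rewrite inE mem_cat gW orbT.
have e1 : agree m x t.
  have := tP 1 (mem_head _ _); rewrite aE.1 aV.1 => e.
  by apply/truncP; rewrite -{1}(homeoVK h x) hP /= e.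
have e2 : agree m (cantor_action eta g t) (h (cantor_action xi g y)).
  by apply/truncP; rewrite hP /= phiE; exact: tP.
apply: agree_trans (mP g gW _ _ e1) _; exact: agreeW e2.
Qed.

End Neighbourhoods.

Lemma nowhere_dense_setC (T : topologicalType) (D : set T) :
  open D -> dense D -> nowhere_dense (~` D).
Proof.
move=> oD dD; rewrite /nowhere_dense -(closure_id _).1; last exact: open_closedC.
rewrite -subset0 => x xD.
have [|y [yD Dy]] := dD (interior (~` D)) _ (open_interior _); first by exists x.
exact: interior_subset yD Dy.
Qed.

Section GenericClass.
Variables (R : realType) (d : nat).
Hypothesis d0 : (0 < d)%N.
Notation F := (free_group d).

(** The index n serves two purposes: as a number of coordinates that must factor
through a finite action, and as the code of a finite action that must be a
factor. *)
Definition generic_at (n : nat) (eta : Xi F) : Prop :=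
  (exists (V : finType) (a : F -> V -> V) (phi : cantor_space -> V) c,
     factors_onto (cantor_action eta) a phi /\ forall x, trunc n x = c (phi x)) /\
  (forall j : model d, unpickle n = Some j ->
     exists phi, factors_onto (cantor_action eta) (model_action j) phi).

Lemma generic_at_open n : open (generic_at n).
Proof.
rewrite openE => eta [[V [a [phi [c [ph cE]]]]] H]; rewrite /interior.
have H1 := factors_onto_near ph.
case e: (unpickle n : option (model d)) => [j|].
  have [psi ps] := H j e.
  apply: filterS (filterI H1 (factors_onto_near ps)) => eta' [/= e1 e2].
  split; first by exists V, a, phi, c.
  by move=> j'; rewrite e => -[<-]; exists psi.
apply: filterS H1 => eta' e1; split; first by exists V, a, phi, c.
by move=> j'; rewrite e.
Qed.

Lemma generic_atP eta : (forall n, generic_at n eta) <->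
  profinite_action (cantor_action eta) /\ universal_action (cantor_action eta).
Proof.
split=> [H|[pe ue] n]; last first.
  split; first exact: (pe _ _ (@trunc_locally_constant n)).
  move=> j _; have [phi ph] := ue _ (model_action j) ord0 (model_actionP j).
  by exists phi.
split=> [K c lc|V a v0 aV].
  have [n nP] := locally_constant_uniform lc.
  have [[V [a [phi [b [ph bE]]]]] _] := H n.
  have cV w : exists e : K, forall x, phi x = w -> c x = e.
    have [[x xw]|nx] := pselect (exists x, phi x = w).
      by exists (c x) => y yw; apply/nP/truncP; rewrite !bE xw yw.
    by exists (c point) => x xw; case: nx; exists x.
  have [c' c'P] := choice cV.
  by exists V, a, phi, c'; split=> // x; exact: c'P.
have [j [from [to [_ _ jE]]]] := model_complete v0 aV.
have [_ /(_ j (pickleK j))[phi [_ lphi phiE]]] := H (pickle j).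
exists (from \o phi); split=> //; first exact: locally_constantS.
by move=> g x; rewrite /= phiE jE.
Qed.

(** Each condition [generic_at] is open, and dense because it holds on the
conjugacy class, which is dense; conversely an action satisfying all of them and
minimal is isomorphic to the universal profinite action, hence conjugate. *)
Theorem generic_conjugacy_class : exists xi : Xi F,
  [/\ conjugacy_class xi `<=` Xi_min_pmp R F,
      comeager [set eta : Xi_min_pmp R F | conjugacy_class xi (val eta)]
    & forall eta, conjugacy_class xi eta ->
        isomorphic_actions (cantor_action eta) (@universal_profinite_action F)].
Proof.
have [xi [mxi pxi uxi]] := profinite_universal_minimal_ex R d0.
have iso eta : minimal_action (cantor_action eta) ->
    profinite_action (cantor_action eta) -> universal_action (cantor_action eta) ->
    isomorphic_actions (cantor_action eta) (@universal_profinite_action F).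
  by apply: isomorphic_completion;
    [exact: cantor_action_continuous|exact: cantor_action_left].
have sub : conjugacy_class xi `<=` Xi_min_pmp R F.
  move=> _ [h _ <-]; split; first exact: conj_minimal.
  by apply: profinite_pmp; [exact: cantor_action_continuous|exact: conj_profinite].
exists xi; split=> //; last first.
  by move=> _ [h _ <-]; apply: iso;
    [exact: conj_minimal|exact: conj_profinite|exact: conj_universal].
pose D n := [set eta : Xi_min_pmp R F | generic_at n (val eta)].
have oD n : open (D n) by exists (generic_at n); first exact: generic_at_open.
exists (fun n => ~` D n) => [n|eta nc]; last first.
  apply: contrapT => H; apply: nc.
  have [pe ue] : profinite_action (cantor_action (val eta)) /\
      universal_action (cantor_action (val eta)).
    by apply/generic_atP => n; apply: contrapT => nD; apply: H; exists n.
  have [me _] := set_mem (valP eta).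
  by apply: conjugate_of_isomorphic; apply: iso.
apply: nowhere_dense_setC => // A [eta Aeta] [A' oA' A'A].
have A'eta : nbhs (val eta) A'.
  by apply: open_nbhs_nbhs; split=> //; move: Aeta; rewrite -A'A.
have [W [m mP]] := Xi_nbhs_base A'eta.
have [meta peta] := set_mem (valP eta).
have [h hP] := conjugates_approximate W m d0 uxi meta peta.
have hc : Xi_min_pmp R F (conj_action h xi) by apply: sub; exists h.
exists (SigSub (mem_set hc)); split.
  by rewrite -A'A; exact: mP.
have : profinite_action (cantor_action (conj_action h xi)) /\
    universal_action (cantor_action (conj_action h xi)).
  by split; [exact: conj_profinite|exact: conj_universal].
by move=> /generic_atP/(_ n).
Qed.

End GenericClass.

(** * Finite subshifts *)

Lemma vietoris_open_base (T : topologicalType) (B : set (vietoris T)) (K : set T) :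
  open B -> B K ->
  exists s : seq (bool * set T),
    (forall p, p \in s -> open p.2 /\ vietoris_subbase p K) /\
    forall K' : set T, (forall p, p \in s -> vietoris_subbase p K') -> B K'.
Proof.
move=> [C CS <-] [D CD DK].
have [E ED DE] := CS D CD; move: DK CD; rewrite -{}DE {D} => DK CD.
exists (finmap.enum_fset E : seq (bool * set T)); split=> [p pE|K' K'P]; first split.
- by have := ED p pE; rewrite inE.
- exact: DK.
- by eexists; [exact: CD|exact: K'P].
Qed.

Lemma finite_uniform_probability (R : realType) dT (T : measurableType dT)
    (V : finType) (v0 : V) (h : V -> T) :
  exists mu : probability T R, forall B,
    (mu B = (\sum_(v : V) (\1_B (h v) : R)%:E)%R * (#|V|%:R^-1)%R%:E)%E.
Proof.
have V0 : (0 < #|V|%:R :> R)%R by rewrite ltr0n; apply/card_gt0P; exists v0.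
have [mu muE] : exists mu : measure T R,
    forall B, (mu B = (\sum_(v : V) (\1_B (h v) : R)%:E)%R)%E.
  exists (msum (fun i : nat => dirac (h (nth v0 (enum V) i))) #|V|) => B.
  transitivity (\sum_(0 <= i < #|V|) (\1_B (h (nth v0 (enum V) i)) : R)%:E)%R.
    by rewrite big_mkord.
  by rewrite cardE -(big_nth v0 xpredT (fun v => (\1_B (h v) : R)%:E)) big_enum.
have muT : mu setT = (#|V|%:R)%R%:E.
  rewrite muE (eq_bigr (fun _ => 1%E)) => [|v _]; last by rewrite indicT.
  by rewrite sumEFin sumr_const.
exists (mnormalize mu (dirac (h v0))) => B.
by rewrite /= /mnormalize muT eqe gt_eqF //= muE.
Qed.

(** The uniform measure. *)
Lemma finite_pmp (R : realType) (G : groupType) (T : ptopologicalType)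
    (alpha : G -> T -> T) : left_action alpha -> finite_set [set: T] ->
  pmp_action R alpha.
Proof.
move=> aA fT; have [V [h [k [hK kK]]]] := finite_type_enum fT.
have [mu muE] := @finite_uniform_probability R _ (borel T) V (k point) h.
exists mu => g B _; rewrite !muE; congr (_ * _)%E.
have inj : injective (fun v => k (alpha g (h v))).
  exact: inj_comp (can_inj kK) (inj_comp (can_inj (left_actionK g aA)) (can_inj hK)).
rewrite [RHS](reindex_inj inj); apply: eq_bigr => v _.
by rewrite kK !indicE.
Qed.

Section FullShift.
Variables (A : finType) (G : groupType).
Notation S := (full_shift A G).

Lemma full_shift_coord (g : G) : locally_constant (fun x : S => x g : A).
Proof.
move=> x; pose Q := fun _ : G => (discrete_topology A : topologicalType).
have H : nbhs (x : prod_topology Q) [set w : prod_topology Q | [set x g] (w g)].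
  apply: (@prod_nbhs_coord _ Q).
  by apply: open_nbhs_nbhs; split => //; exact: discrete_open.
exact: H.
Qed.

Lemma full_shift_hausdorff : hausdorff_space S.
Proof.
apply: separated_hausdorff => x y xy.
have [g xyg] : exists g, x g <> y g.
  by apply/existsNP => e; apply: xy; apply/funext.
exists (fun z : S => x g == z g :> A); last first.
  by rewrite eqxx => /esym/eqP.
exact: (locally_constantS (fun a => x g == a :> A) (full_shift_coord g)).
Qed.

Lemma full_shift_compact : compact [set: S].
Proof.
have := @tychonoff _ (fun _ : G => discrete_topology A) (fun _ => setT)
  (fun _ => @finite_compact (discrete_topology A) setT (@finite_finset A setT)).
by congr compact; apply/seteqP; split.
Qed.

Lemma shift_left_action : left_action (@shift_action A G).
Proof.
split=> [x|g h x]; apply/funext => k; rewrite /shift_action.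
  by rewrite invg1 mul1g.
by rewrite invgM mulgA.
Qed.

Lemma shift_continuous g : continuous (@shift_action A G g).
Proof.
apply: (@prod_locally_constant_continuous _ _ (fun _ : G => discrete_topology A)) => h.
exact: full_shift_coord.
Qed.

End FullShift.

Lemma subshift_left_action (A : finType) (G : groupType) (X : subshifts A G) :
  left_action (@subshift_action A G X).
Proof.
have [s1 sM] := shift_left_action A G.
by split=> [x|g h x]; apply: val_inj; rewrite /= ?s1 ?sM.
Qed.

Lemma subshift_val_continuous (A : finType) (G : groupType) (X : subshifts A G) :
  continuous (fun x : subshift_space X => val x : full_shift A G).
Proof. exact: initial_continuous. Qed.

Lemma subshift_continuous (A : finType) (G : groupType) (X : subshifts A G) g :
  continuous (@subshift_action A G X g).
Proof.
apply: continuous_comp_initial => x.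
apply: (@continuous_comp _ _ _ (fun x : subshift_space X => val x : full_shift A G)
  (@shift_action A G g)).
  exact: subshift_val_continuous.
exact: shift_continuous.
Qed.

Section FiniteSubshifts.
Variables (R : realType) (d : nat) (A : finType).
Hypothesis d0 : (0 < d)%N.
Notation F := (free_group d).
Notation S := (full_shift A F).

(** Around each point of K some cylinder lies in U, and by compactness of K the
lengths of these cylinders can be bounded. *)
Lemma pattern_window (K U : set S) : closed K -> open U -> K `<=` U ->
  exists W : seq F, forall x y : S, K x -> (forall g, g \in W -> x g = y g) -> U y.
Proof.
move=> cK oU KU.
have cptK : compact K by apply: subclosed_compact cK (@full_shift_compact A F) _.
have [||n nP] := @compact_uniform S K
  (fun n x => forall y : S, (forall g : F, (pickle g < n)%N -> x g = y g) -> U y) cptK.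
- by move=> n m x nm H y xy; apply: H => g gn; apply: xy; exact: leq_trans nm.
- move=> x Kx.
  have [W [V [Vx VU]]] := prod_nbhs_base (open_nbhs_nbhs (conj oU (KU x Kx))).
  exists (\max_(g <- W) pickle g).+1.
  have H : \forall y \near x, forall g, g \in W -> y g = x g.
    elim: {VU} W => [|g W IH]; first by apply: filterE.
    apply: filterS (filterI (@full_shift_coord A F g x) IH) => y [/= e1 e2] h.
    by rewrite inE => /predU1P[->|/e2].
  apply: filterS H => y xy z yz; apply: VU => g gW.
  rewrite -yz ?xy //; first exact: nbhs_singleton (Vx g).
  by rewrite ltnS; exact: leq_bigmax_seq.
exists (pmap unpickle (iota 0 n)) => x y Kx xy; apply: (nP x Kx) => g gn.
by apply: xy; rewrite mem_pmap -(pickleK g) map_f // mem_iota.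
Qed.

(** The configuration of v records the colours along its orbit, read backwards so
that the shift corresponds to the action; a single orbit is taken, which makes
the subshift minimal. *)
Lemma orbit_subshift (V : finType) (a : F -> V -> V) (c : V -> A) (v0 : V) :
  left_action a -> exists Y : subshifts A F,
    [/\ minimal_action (@subshift_action A F Y), finite_subshift Y
      & forall y : S, val Y y -> exists v, forall h, y h = c (a h^-1 v)].
Proof.
move=> aV; pose y v : S := fun h => c (a h^-1 v).
have yE g v : shift_action g (y v) = y (a g v).
  by apply/funext => h; rewrite /shift_action /y invgM invgK aV.2.
pose Y : set S := range (fun g => y (a g v0)).
have fY : finite_set Y.
  apply: sub_finite_set (finite_image y (@finite_finset V setT)).
  by move=> _ [g _ <-]; exists (a g v0).
have YS : subshifts A F Y.
  split.
  - by exists (y (a 1 v0)); exists 1.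
  - by apply: compact_closed (finite_compact fY); exact: full_shift_hausdorff.
  - by move=> g _ [_ [h _ <-] <-]; exists (g * h) => //; rewrite yE aV.2.
pose YY : subshifts A F := SigSub (mem_set YS).
exists YY; split=> //; last by move=> _ [g _ <-]; exists (a g v0).
apply: visits_minimal => U x _ [u Uu].
have [h _ hE] := set_mem (valP u); have [g _ gE] := set_mem (valP x).
exists (h * g^-1); suff -> : subshift_action (h * g^-1) x = u by [].
apply: val_inj; rewrite /= -hE -gE yE; congr y.
by rewrite aV.2 left_actionK.
Qed.

Lemma subshift_patterns (X : subshifts A F) (W : seq F) :
  pmp_action R (@subshift_action A F X) ->
  exists (V : finType) (v0 : V) (a : F -> V -> V) (c : V -> A),
    left_action a /\ forall v, exists2 x : S, val X x &
      forall g, g \in W -> x g = c (a g^-1 v).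
Proof.
move=> [mu muE].
pose col (t : subshift_space X) : A := val t 1.
have lcol : locally_constant col.
  exact: locally_constant_comp (@subshift_val_continuous _ _ X) (@full_shift_coord A F 1).
have [||V [v0 [a [c [aV cP]]]]] := @finite_pattern_model d R _ (borel (subshift_space X))
    mu (@subshift_action A F X) A col [seq g^-1 | g <- W] d0 (@subshift_left_action _ _ X).
- move=> g B mB; split; last exact: muE.
  by apply: continuous_measurable mB; exact: subshift_continuous.
- by move=> p; apply: sub_sigma_algebra; exact: locally_constant_open.
exists V, v0, a, c; split=> // v; have [t tP] := cP v.
exists (val t) => [|g gW]; first exact: set_mem (valP t).
by rewrite -tP ?map_f // /col /= /shift_action invgK mulg1.
Qed.

Lemma minimal_meets (X : subshifts A F) (U : set S) :
  minimal_action (@subshift_action A F X) -> open U -> val X `&` U !=set0 ->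
  forall x, val X x -> exists g, U (shift_action g x).
Proof.
move=> mX oU [u [Xu Uu]] x Xx.
pose emb (t : subshift_space X) : S := val t.
have [||g gU] := @minimal_visits F _ (@subshift_action A F X) (emb @^-1` U)
    (SigSub (mem_set Xx)) (@subshift_continuous _ _ X) (@subshift_left_action _ _ X) mX.
- by have /continuousP := @subshift_val_continuous _ _ X; exact.
- by exists (SigSub (mem_set Xu)).
- by exists g.
Qed.

(** A window is chosen for each subbasic set containing X. If the set requires
Y to meet U, the window is taken for the union of the translates of U, which
contains X by minimality; a translate of a point of Y then lies in U. *)
Theorem finite_subshifts_dense :
  dense [set X : S_min_pmp R A F | finite_subshift (val X)].
Proof.
move=> Q [X QX] [Q1 [Q2 oQ2 Q2E] Q1E].
have [mX pX] := set_mem (valP X).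
have [Xne cX iX] := subshiftP (val X).
have Q2X : Q2 (val (val X)) by move: QX; rewrite -Q1E -Q2E.
have [s [sX sP]] := vietoris_open_base oQ2 Q2X.
have window p : exists W : seq F, p \in s -> forall Y : subshifts A F,
    (forall y : S, val Y y -> exists2 x : S, val (val X) x &
       forall g, g \in W -> x g = y g) ->
    vietoris_subbase p (val Y).
  have [ps|nps] := boolP (p \in s); last by exists [::].
  have [op Xp] := sX p ps; move: op Xp; rewrite /vietoris_subbase.
  case: p {ps} => -[] /= U oU XU.
    have [W WP] := pattern_window cX oU XU.
    by exists W => _ Y YP y /YP[x Xx /WP]; apply.
  have oU' : open (\bigcup_g (@shift_action A F g @^-1` U)).
    apply: bigcup_open => g _.
    by have /continuousP := @shift_continuous A F g; exact.
  have [|W WP] := pattern_window cX oU'.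
    by move=> x Xx; have [g gU] := minimal_meets mX oU XU Xx; exists g.
  exists W => _ Y YP; have [[y Yy] _ iY] := subshiftP Y.
  have [x Xx xy] := YP y Yy; have [g _ gU] := WP x y Xx xy.
  by exists (shift_action g y); split => //; apply: (iY g); exists y.
have [W WP] := choice window.
have [V [v0 [a [c [aV cP]]]]] := subshift_patterns (flatten [seq W p | p <- s]) pX.
have [Y [mY fY YP]] := orbit_subshift c v0 aV.
have YS : S_min_pmp R A F Y.
  split=> //; apply: finite_pmp; first exact: subshift_left_action.
  have -> : [set: subshift_space Y] = (fun y : subshift_space Y => val y) @^-1` val Y.
    by apply/seteqP; split=> // y _; exact: set_mem (valP y).
  by apply: finite_preimage fY => y z _ _ /val_inj.
exists (SigSub (mem_set YS)); split=> //.
rewrite -Q1E -Q2E /=; apply: sP => p ps; apply: (WP p ps) => y /YP[v yv].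
have [x Xx xP] := cP v; exists x => // g gW; rewrite yv; apply: xP.
by apply/flatten_mapP; exists p.
Qed.

End FiniteSubshifts.

Unset Implicit Arguments.

Theorem theorem1p5 (R : realType) (d : nat) (d_ge1 : (1 <= d)%N) :
  (forall A : finType, (0 < #|A|)%N ->
     dense [set X : S_min_pmp R A (free_group d) | finite_subshift (val X)])
  /\
  (exists xi : Xi (free_group d),
     [/\ conjugacy_class xi `<=` Xi_min_pmp R (free_group d),
         comeager [set eta : Xi_min_pmp R (free_group d) |
                     conjugacy_class xi (val eta)]
       & forall eta, conjugacy_class xi eta ->
           isomorphic_actions (cantor_action eta)
             (@universal_profinite_action (free_group d))]).
Proof.
split=> [A _|]; first exact: finite_subshifts_dense.
exact: generic_conjugacy_class.
Qed.
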